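(* Let $M$ be a lightlike hypersurface of an indefinite statistical manifold $(\overline{M},\overline{g},\overline{\nabla},\overline{\nabla}^{*})$, with screen distribution $S(TM)$, radical distribution $\mathrm{Rad}(TM)$ spanned by $\xi$, and induced connections $\nabla$ and $\nabla^{*}$. Suppose that $\mathrm{Rad}(TM)$ and $S(TM)$ are parallel with respect to both $\nabla$ and $\nabla^{*}$ and that $\nabla$ is a metric connection. Let $R,R^{*},R^{0}$ be the curvature tensors of $\nabla,\nabla^{*},\nabla^{0}$. Then $$R(X,Y)W=R^{*}(X,Y)W=R^{0}(X,Y)W$$ for all $X,Y\in\Gamma(TM)$ and $W\in\Gamma(S(TM))$. Moreover, $$R=R^{*}\quad\Longleftrightarrow\quad d\tau=d\tau^{*},$$ and whenever these equivalent conditions hold, $R=R^{*}=R^{0}$.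
   Context: $\Gamma(E)$ denotes smooth sections of $E$. An indefinite statistical manifold $(\overline{M},\overline{g},\overline{\nabla},\overline{\nabla}^{*})$ is a semi-Riemannian manifold $(\overline M,\overline g)$ with a torsion-free affine connection $\overline\nabla$ satisfying the Codazzi condition $(\overline{\nabla}_{X}\overline{g})(Y,Z)=(\overline{\nabla}_{Y}\overline{g})(X,Z)$, together with the dual connection $\overline\nabla^{*}$ determined by $X\overline{g}(Y,Z)=\overline{g}(\overline{\nabla}_{X}Y,Z)+\overline{g}(Y,\overline{\nabla}^{*}_{X}Z)$ (which is then also torsion-free). $M$ is a lightlike hypersurface: $M$ has codimension one and the induced metric $g$ is degenerate, so $\mathrm{Rad}(TM)=TM\cap TM^{\perp}=TM^{\perp}$ is a rank-one bundle. A screen distribution $S(TM)$ is a non-degenerate distribution complementary to $\mathrm{Rad}(TM)$ in $TM$; one is fixed. Fix a nowhere-zero section $\xi$ of $\mathrm{Rad}(TM)$ (in general it exists only locally, and all objects depending on it are understood on its domain). $N$ is the unique vector field along $M$ with $\overline{g}(N,N)=0$, $\overline{g}(N,\xi)=1$, $\overline{g}(N,W)=0$ for all $W\in\Gamma(S(TM))$; then $T\overline M|_M=TM\oplus\mathrm{span}\{N\}$. For $X,Y\in\Gamma(TM)$ the Gauss formulas $\overline{\nabla}_{X}Y=\nabla_{X}Y+B(X,Y)N$ and $\overline{\nabla}^{*}_{X}Y=\nabla^{*}_{X}Y+B^{*}(X,Y)N$, with $\nabla_XY,\nabla^*_XY\in\Gamma(TM)$, define the induced torsion-free connections $\nabla,\nabla^{*}$;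 put $\nabla^{0}=\frac12(\nabla+\nabla^{*})$. The one-forms $\tau,\tau^{*}$ (and screen-valued operators $A_\xi,A_\xi^*:TM\to S(TM)$) are defined by $\nabla_{X}\xi=-A_{\xi}X-\tau(X)\xi$ and $\nabla^{*}_{X}\xi=-A^{*}_{\xi}X-\tau^{*}(X)\xi$. Conventions: $R(X,Y)Z=\nabla_X\nabla_YZ-\nabla_Y\nabla_XZ-\nabla_{[X,Y]}Z$, and analogously for $R^{*}$ (with $\nabla^{*}$) and $R^{0}$ (with $\nabla^{0}$); the exterior derivative is normalized by $2d\tau(X,Y)=X(\tau(Y))-Y(\tau(X))-\tau([X,Y])$, and analogously for $\tau^{*}$. A connection $D$ on $M$ is called a metric connection if $Dg=0$. A distribution $\mathcal D$ on $M$ is parallel with respect to $D$ if $D_XY\in\Gamma(\mathcal D)$ for all $X\in\Gamma(TM)$, $Y\in\Gamma(\mathcal D)$. *)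

(* Defs.v *)
From HB Require Import structures.
From mathcomp Require Import all_boot all_order all_algebra.
From mathcomp Require Import all_classical all_reals all_analysis.
Set Implicit Arguments.
Unset Strict Implicit.
Unset Printing Implicit Defensive.
Import Order.TTheory GRing.Theory Num.Theory.
Import numFieldNormedType.Exports.
Local Open Scope classical_set_scope.
Local Open Scope ring_scope.

Section SmoothMaps.
Context {R : realType} {V W : normedModType R}.

Fixpoint C_on (k : nat) (U : set V) (f : V -> W) : Prop :=
  match k with
  | 0 => forall x, U x -> {for x, continuous f}
  | k'.+1 => (forall x, U x -> differentiable f x) /\
             forall v, C_on k' U (fun x => 'D_v f x)
  end.

Definition smooth_on (U : set V) (f : V -> W) : Prop := forall k, C_on k U f.

End SmoothMaps.

(* A smooth manifold of dimension n. The atlas is indexed by the points: chart  *)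
(* p is a chart around p. As p ranges over M these charts form an atlas, and    *)
(* any maximal atlas is generated by such a choice. psi p is the inverse of the *)
(* chart phi p; phi p and psi p are irrelevant outside dom p and its image.     *)
Record manifold (R : realType) (n : nat) := Manifold {
  pt :> topologicalType ;
  dom : pt -> set pt ;
  phi : pt -> pt -> 'rV[R]_n ;
  psi : pt -> 'rV[R]_n -> pt ;
  hausdorff_pt : hausdorff_space pt ;
  second_countable_pt : @second_countable pt ;
  open_dom : forall p, open (dom p) ;
  mem_dom : forall p, dom p p ;
  open_codom : forall p, open (phi p @` dom p) ;
  phiK : forall p q, dom p q -> psi p (phi p q) = q ;
  phi_continuous : forall p q, dom p q -> {for q, continuous (phi p)} ;
  psi_continuous : forall p q, dom p q -> {for phi p q, continuous (psi p)} ;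
  transition_smooth : forall p q,
    smooth_on (phi p @` (dom p `&` dom q)) (phi q \o psi p) }.
Arguments dom {R n m} : rename.
Arguments phi {R n m} : rename.
Arguments psi {R n m} : rename.

(* The tangent space T_p M is represented by 'rV[R]_n, through the coordinates  *)
(* of the chart at p. Thus a vector field is a function X : M -> 'rV[R]_n in    *)
(* which X p has to be read in the chart at p.                                  *)
Section Tangent.
Context {R : realType} {n : nat} {M : manifold R n}.

(* At the point q, from coordinates in the chart p to coordinates in chart p'.  *)
Definition chart_change (p p' q : M) : 'rV[R]_n -> 'rV[R]_n :=
  'd (phi p' \o psi p) (phi p q).

(* The coordinate field d/dx^a of the chart at p; meaningful on dom p only.     *)
Definition coord_field (p : M) (a : 'I_n) (q : M) : 'rV[R]_n :=
  chart_change p q q (delta_mx 0 a).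

Definition smooth_at {W : normedModType R} (p : M) (f : M -> W) : Prop :=
  exists U : set 'rV[R]_n,
    [/\ open U, U (phi p p) & smooth_on U (f \o psi p)].

Definition smooth_fun (V : set M) (f : M -> R) : Prop :=
  forall p, V p -> smooth_at p f.

(* v(f), for v in T_p M. *)
Definition deriv {W : normedModType R} (p : M) (v : 'rV[R]_n) (f : M -> W) : W :=
  'D_v (f \o psi p) (phi p p).

End Tangent.

Section Maps.
Context {R : realType} {m n : nat} {M : manifold R m} {N : manifold R n}.
Variable F : M -> N.

Definition smooth_map : Prop := forall p,
  {for p, continuous F} /\ smooth_at p (phi (F p) \o F).

Definition tangent_map (p : M) : 'rV[R]_m -> 'rV[R]_n :=
  'd (phi (F p) \o F \o psi p) (phi p p).

Definition immersion : Prop :=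
  smooth_map /\ forall p, injective (tangent_map p).

(* Smooth sections over V of the pulled back bundle F^* TN; such a Z satisfies  *)
(* Z q \in T_{F q} N.                                                           *)
Definition section_along (V : set M) (Z : M -> 'rV[R]_n) : Prop :=
  forall p, V p ->
    smooth_at p (fun q => chart_change (F q) (F p) (F q) (Z q)).

End Maps.

Section Fields.
Context {R : realType} {n : nat} {M : manifold R n}.

Local Notation vect := 'rV[R]_n.
Local Notation field := (M -> 'rV[R]_n).

Definition vector_field (V : set M) (X : field) : Prop :=
  section_along idfun V X.

Definition bracket (X Y : field) (p : M) : vect :=
  deriv p (X p) (fun q => chart_change q p q (Y q)) -
  deriv p (Y p) (fun q => chart_change q p q (X q)).

Definition one_form (V : set M) (t : M -> vect -> R) : Prop :=
  (forall p, V p -> forall (a : R) u v, t p (a *: u + v) = a * t p u + t p v) /\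
  forall V', open V' -> V' `<=` V -> forall X, vector_field V' X ->
    smooth_fun V' (fun q => t q (X q)).

(* The normalization is 2 dt(X, Y) = X(t(Y)) - Y(t(X)) - t([X, Y]). *)
Definition ext_deriv (t : M -> vect -> R) (X Y : field) (p : M) : R :=
  2^-1 * (deriv p (X p) (fun q => t q (Y q)) -
          deriv p (Y p) (fun q => t q (X q)) - t p (bracket X Y p)).

(* nabla p v Y stands for (nabla_v Y)(p), v in T_p M. A field Y is a total      *)
(* function, and nabla p v Y is meaningful when Y is smooth around p: this      *)
(* encodes the connection on all open subsets, the restriction maps being       *)
(* accounted for by conn_local.                                                 *)
Definition cov (nabla : M -> vect -> field -> vect) (X Y : field) : field :=
  fun p => nabla p (X p) Y.

Record affine_connection (nabla : M -> vect -> field -> vect) : Prop := {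
  conn_smooth : forall V, open V -> forall X Y,
    vector_field V X -> vector_field V Y -> vector_field V (cov nabla X Y) ;
  conn_local : forall V, open V -> forall Y Y',
    vector_field V Y -> vector_field V Y' ->
    (forall q, V q -> Y q = Y' q) ->
    forall p v, V p -> nabla p v Y = nabla p v Y' ;
  conn_linear : forall V, open V -> forall Y, vector_field V Y ->
    forall p (a : R) u v, V p ->
    nabla p (a *: u + v) Y = a *: nabla p u Y + nabla p v Y ;
  conn_add : forall V, open V -> forall Y Z,
    vector_field V Y -> vector_field V Z -> forall p v, V p ->
    nabla p v (fun q => Y q + Z q) = nabla p v Y + nabla p v Z ;
  conn_leibniz : forall V, open V -> forall f Y,
    smooth_fun V f -> vector_field V Y -> forall p v, V p ->
    nabla p v (fun q => f q *: Y q) = deriv p v f *: Y p + f p *: nabla p v Y }.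

Definition torsion_free (nabla : M -> vect -> field -> vect) : Prop :=
  forall V, open V -> forall X Y, vector_field V X -> vector_field V Y ->
  forall p, V p -> cov nabla X Y p - cov nabla Y X p = bracket X Y p.

(* (nabla_X b)(Y, Z) *)
Definition cov_form (nabla : M -> vect -> field -> vect)
    (b : M -> vect -> vect -> R) (X Y Z : field) (p : M) : R :=
  deriv p (X p) (fun q => b q (Y q) (Z q)) -
  b p (cov nabla X Y p) (Z p) - b p (Y p) (cov nabla X Z p).

Definition curvature (nabla : M -> vect -> field -> vect) (X Y Z : field)
    (p : M) : vect :=
  cov nabla X (cov nabla Y Z) p - cov nabla Y (cov nabla X Z) p -
  cov nabla (bracket X Y) Z p.

Definition mean_connection (nabla nabla' : M -> vect -> field -> vect) :
    M -> vect -> field -> vect :=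
  fun p v Y => 2^-1 *: (nabla p v Y + nabla' p v Y).

(* Here and below, X in Gamma(E) ranges over the smooth sections of E over the  *)
(* open subsets of the set U on which the objects are defined.                  *)
Definition metric_connection (U : set M) (b : M -> vect -> vect -> R)
    (nabla : M -> vect -> field -> vect) : Prop :=
  forall V, open V -> V `<=` U -> forall X Y Z,
  vector_field V X -> vector_field V Y -> vector_field V Z ->
  forall p, V p -> cov_form nabla b X Y Z p = 0.

Definition section_of (D : M -> set vect) (V : set M) (X : field) : Prop :=
  vector_field V X /\ forall p, V p -> D p (X p).

Definition parallel (U : set M) (D : M -> set vect)
    (nabla : M -> vect -> field -> vect) : Prop :=
  forall V, open V -> V `<=` U -> forall X Y,
  vector_field V X -> section_of D V Y -> section_of D V (cov nabla X Y).

Definition smooth_distribution (D : M -> {vspace vect}) : Prop :=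
  forall p, exists (V : set M) (s : seq field),
  [/\ open V, V p, (forall i, (i < size s)%N -> vector_field V (nth 0 s i))
    & forall q, V q -> basis_of (D q) [seq E q | E : field <- s]].

Definition has_index (b : vect -> vect -> R) (nu : nat) : Prop :=
  let neg_def (W : {vspace vect}) :=
    forall w, w \in W -> w != 0 -> b w w < 0 in
  (exists2 W, neg_def W & \dim W = nu) /\
  (forall W, neg_def W -> (\dim W <= nu)%N).

Record semi_riemannian (g : M -> vect -> vect -> R) : Prop := {
  metric_linear : forall p (a : R) u v w,
    g p (a *: u + v) w = a * g p u w + g p v w ;
  metric_sym : forall p u v, g p u v = g p v u ;
  metric_nondegenerate : forall p u, (forall v, g p u v = 0) -> u = 0 ;
  metric_smooth : forall V, open V -> forall X Y,
    vector_field V X -> vector_field V Y ->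
    smooth_fun V (fun q => g q (X q) (Y q)) ;
  metric_index : exists nu, forall p, has_index (g p) nu }.

Record statistical_manifold (g : M -> vect -> vect -> R)
    (nabla nablas : M -> vect -> field -> vect) : Prop := {
  stat_metric : semi_riemannian g ;
  stat_connection : affine_connection nabla ;
  stat_torsion_free : torsion_free nabla ;
  stat_codazzi : forall V, open V -> forall X Y Z,
    vector_field V X -> vector_field V Y -> vector_field V Z ->
    forall p, V p -> cov_form nabla g X Y Z p = cov_form nabla g Y X Z p ;
  stat_dual_connection : affine_connection nablas ;
  stat_duality : forall V, open V -> forall X Y Z,
    vector_field V X -> vector_field V Y -> vector_field V Z ->
    forall p, V p ->
    deriv p (X p) (fun q => g q (Y q) (Z q)) =
    g p (cov nabla X Y p) (Z p) + g p (Y p) (cov nablas X Z p) }.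

Definition same_curvature (U : set M)
    (nabla nabla' : M -> vect -> field -> vect) : Prop :=
  forall V, open V -> V `<=` U -> forall X Y Z,
  vector_field V X -> vector_field V Y -> vector_field V Z ->
  forall p, V p -> curvature nabla X Y Z p = curvature nabla' X Y Z p.

Definition same_ext_deriv (U : set M) (t t' : M -> vect -> R) : Prop :=
  forall V, open V -> V `<=` U -> forall X Y,
  vector_field V X -> vector_field V Y ->
  forall p, V p -> ext_deriv t X Y p = ext_deriv t' X Y p.

End Fields.

Section Hypersurface.
Context {R : realType} {n : nat} {Mb : manifold R n.+1} {M : manifold R n}.
Variables (F : M -> Mb) (gb : Mb -> 'rV[R]_n.+1 -> 'rV[R]_n.+1 -> R).

Local Notation vect := 'rV[R]_n.
Local Notation vectb := 'rV[R]_n.+1.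
Local Notation field := (M -> 'rV[R]_n).

Definition induced_metric (p : M) (v w : vect) : R :=
  gb (F p) (tangent_map F p v) (tangent_map F p w).

Definition normal_space (p : M) : set vectb :=
  [set u | forall w : vect, gb (F p) u (tangent_map F p w) = 0].

(* Rad(TM) = TM \cap TM^\perp, as a subspace of T_p M. *)
Definition radical (p : M) : set vect :=
  [set v | normal_space p (tangent_map F p v)].

Definition lightlike_hypersurface : Prop :=
  immersion F /\ forall p, exists2 v : vect, v != 0 &
    forall w, induced_metric p v w = 0.

Record screen_distribution (S : M -> {vspace vect}) : Prop := {
  screen_smooth : smooth_distribution S ;
  screen_nondegenerate : forall p w, w \in S p ->
    (forall w', w' \in S p -> induced_metric p w w' = 0) -> w = 0 ;
  screen_sum : forall p v, exists w r,
    [/\ w \in S p, radical p r & v = w + r] ;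
  screen_direct : forall p v, v \in S p -> radical p v -> v = 0 }.

Definition radical_section (U : set M) (xi : field) : Prop :=
  section_of radical U xi /\ forall p, U p -> xi p != 0.

Definition transversal_section (S : M -> {vspace vect}) (U : set M)
    (xi : field) (N : M -> vectb) : Prop :=
  section_along F U N /\ forall p, U p ->
    [/\ gb (F p) (N p) (N p) = 0, gb (F p) (N p) (tangent_map F p (xi p)) = 1
      & forall w, w \in S p -> gb (F p) (N p) (tangent_map F p w) = 0].

(* nabla_v Z for Z a section of F^* T(Mb), v in T_p M: the connection on        *)
(* F^* T(Mb) induced by nabla, i.e. the only one such that the derivative of    *)
(* Zb \o F along v is nabla_{dF v} Zb for each field Zb on Mb. It is computed   *)
(* from Z = sum_a Z^a (d/dx^a \o F) around p, in the chart x at F p.            *)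
Definition cov_along (nabla : Mb -> vectb -> (Mb -> vectb) -> vectb)
    (p : M) (v : vect) (Z : M -> vectb) : vectb :=
  deriv p v (fun q => chart_change (F q) (F p) (F q) (Z q)) +
  \sum_(a < n.+1)
    Z p 0 a *: nabla (F p) (tangent_map F p v) (coord_field (F p) a).

(* nablab_X Y = nabla_X Y + B(X, Y) N, with nabla_X Y in Gamma(TM). *)
Definition gauss_formula (nablab : Mb -> vectb -> (Mb -> vectb) -> vectb)
    (U : set M) (N : M -> vectb) (nabla : M -> vect -> field -> vect)
    (B : M -> vect -> vect -> R) : Prop :=
  forall V, open V -> V `<=` U -> forall X Y,
  vector_field V X -> vector_field V Y ->
  vector_field V (cov nabla X Y) /\
  forall p, V p ->
    cov_along nablab p (X p) (fun q => tangent_map F q (Y q)) =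
    tangent_map F p (cov nabla X Y p) + B p (X p) (Y p) *: N p.

(* nabla_X xi = - A X - tau(X) xi *)
Definition weingarten_xi (S : M -> {vspace vect}) (U : set M) (xi : field)
    (nabla : M -> vect -> field -> vect) (A : M -> vect -> vect)
    (tau : M -> vect -> R) : Prop :=
  one_form U tau /\
  forall p, U p -> forall v,
    A p v \in S p /\ nabla p v xi = - A p v - tau p v *: xi p.

End Hypersurface.

(* Main.v *)
(* For screen sections Y and W, metricity of nabla and the duality of the two  *)
(* ambient connections compute the derivative of g(Y, W) in two ways, whence   *)
(* g(Y, nabla_X W - nabla*_X W) = 0. Both derivatives lie in the non-          *)
(* degenerate screen, so nabla = nabla* = nabla0 there, and the curvatures     *)
(* agree because the screen is parallel. Since Rad(TM) is parallel too,        *)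
(* nabla_X xi = - tau(X) xi, and thus R(X, Y) xi = - 2 dtau(X, Y) xi (likewise *)
(* for nabla*, and for nabla0 with (tau + tau* )/2). The difference of two     *)
(* curvatures being tensorial, it is enough to compare them on the screen and  *)
(* on xi.                                                                      *)

From HB Require Import structures.
Require Import Defs.
From mathcomp Require Import all_boot all_order all_algebra.
From mathcomp Require Import all_classical all_reals all_analysis.
From mathcomp Require Import ring.
(* Otherwise [deriv] would be the formal derivative of polynomials. *)
Import Defs.
Import Order.TTheory GRing.Theory Num.Theory.
Import numFieldNormedType.Exports.
Local Open Scope classical_set_scope.
Local Open Scope ring_scope.

Set Implicit Arguments.
Unset Strict Implicit.
Unset Printing Implicit Defensive.

(** * Smooth maps between normed modules *)

(** Two tests decide everything, one on the screen and one on [xi]. On the screen,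
    [screen_connections_agree] identifies [nabla] with [nablas]; parallelism keeps first derivatives
    inside the screen, so the identification applies twice and the curvatures agree
    ([curvature_agree]). On [xi], parallelism of the radical kills the screen part of the derivative
    ([weingarten_recurrent]), so [xi] is recurrent and its curvature is the exterior derivative of
    the recurrence form ([curvature_recurrent]). The difference of two curvatures is a tensor in the
    last argument ([curvature_diff_tensor]) and the screen and [xi] span the tangent space
    ([screen_decomposition]). Hence [same_curvatureP]: two connections that pass both tests have the
    same curvature exactly when their recurrence forms have the same exterior derivative. It is
    applied to [nabla] and [nablas], then to [nabla0] and [nablas], the form of [nabla0] being the
    mean of [tau] and [taus]. Two preparations carry the geometry. The induced connections are given
    only through the Gauss formulas, so their axioms are inherited from [cov_along] by uniqueness of
    the splitting into a tangent part and a multiple of [N] ([gauss_affine]). The ambient duality is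
    given for fields on [Mb], and [duality_along] transports it to fields along [F]. Since a vector
    at q is read in the chart at q, smoothness is always proved by passing to one fixed chart around
    p ([smooth_atP], [chart_change_comp], [deriv_chart]). *)

Section SmoothCalculus.
Context {R : realType}.
Implicit Types V W : normedModType R.

Lemma near_eq_differentiable V W (f g : V -> W) (x : V) :
  (\near x, f x = g x) -> differentiable f x -> differentiable g x.
Proof.
move=> fg df; have fgx := nbhs_singleton fg.
(* The expansion of [f] at [x] also expands [g]; uniqueness of the differential then identifies
   ['d g x] with ['d f x]. *)
have dg : g \o shift x = cst (g x) + 'd f x +o_ 0 id.
  apply/eqaddoP => e e0; have /eqaddoP/(_ e e0) := diff_locally df.
  have : \forall h \near (0 : V), f (h + x) = g (h + x).
    by move: fg; rewrite (near_shift 0)/= => /filterS; apply => h /=; rewrite subr0.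
  apply: filterS2 => h fgh.
  by rewrite -![(_ - _) h]/(_ h - _ h) /= -![(cst _ + _) h]/(_ + _) /= fgh fgx.
have dfc := diff_continuous df.
by apply/diff_locallyP; rewrite (diff_unique dfc dg).
Qed.

(** Scaling is a continuous bilinear map, so this is the chain rule for that map after
    [y |-> (f y, g y)]. *)
Lemma is_diff_scale V W (f : V -> R) (g : V -> W) (x : V) :
  differentiable f x -> differentiable g x ->
  is_diff x (fun y => f y *: g y)
    (fun v => f x *: 'd g x v + 'd f x v *: g x).
Proof.
move=> df dg.
have bil : bilinear_for (GRing.Scale.Law.clone _ _ *:%R _)
    (GRing.Scale.Law.clone _ _ *:%R _) (@GRing.scale R W).
  split=> [w|a] b u v /=.
  - by rewrite scalerDl scalerA.
  - by rewrite scalerDr !scalerA mulrC.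
pose sM := bilinear_isBilinear.Build R R W W _ _ (@GRing.scale R W) bil.
pose s : {bilinear R -> W -> W} := HB.pack (@GRing.scale R W) sM.
have sc : continuous (fun p : R * W => s p.1 p.2).
  by move=> p; exact: scale_continuous.
pose fg := fun y => (f y, g y).
have dfg : differentiable fg x by exact: differentiable_pair.
have ds := @differentiable_bilin _ _ _ _ s (fg x) sc.
apply: DiffDef; first exact: (differentiable_comp dfg ds).
rewrite (_ : (fun y => f y *: g y) = (fun p => s p.1 p.2) \o fg)//.
rewrite diff_comp// diff_bilin// funeqE => v /=.
by rewrite diff_pair.
Qed.

End SmoothCalculus.

Section ContinuouslyDifferentiable.
Context {R : realType}.
Implicit Types V W : normedModType R.

Lemma nearbyT V (U : set V) (P : V -> Prop) (x : V) :
  open U -> U x -> (forall y, U y -> P y) -> \near x, P x.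
Proof.
by move=> oU Ux UP; apply: filterS (open_nbhs_nbhs (conj oU Ux)).
Qed.

Lemma derive_scale V W (f : V -> R) (g : V -> W) (x v : V) :
  differentiable f x -> differentiable g x ->
  'D_v (fun y => f y *: g y) x = f x *: 'D_v g x + 'D_v f x *: g x.
Proof.
move=> df dg; have [dfg E] := is_diff_scale df dg.
by rewrite !deriveE// E.
Qed.

Lemma derive_comp_rV V W m (f : 'rV[R]_m -> W) (g : V -> 'rV[R]_m) (x v : V) :
  differentiable g x -> differentiable f (g x) ->
  'D_v (f \o g) x = 'D_('D_v g x) f (g x).
Proof.
move=> dg df; rewrite deriveE; last exact: differentiable_comp.
by rewrite diff_comp//= (deriveE v dg) deriveE.
Qed.

Lemma derive_rV W m (f : 'rV[R]_m -> W) x v : differentiable f x ->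
  'D_v f x = \sum_a v 0 a *: 'D_(delta_mx 0 a) f x.
Proof.
move=> df; rewrite deriveE// {1}[v]row_sum_delta linear_sum.
by apply: eq_bigr => a _; rewrite linearZ/= deriveE.
Qed.

Lemma C_on_ext V W k (U : set V) (f g : V -> W) : open U ->
  (forall x, U x -> f x = g x) -> C_on k U f -> C_on k U g.
Proof.
elim: k f g => [|k IH] f g oU fg /=.
  move=> cf x Ux; have fgx := nearbyT oU Ux fg.
  have fg' : f @ x --> g x by rewrite -(fg _ Ux); exact: cf.
  by apply: cvg_trans fg'; apply: near_eq_cvg; apply: filterS fgx.
move=> [df Df]; split=> [x Ux|v].
  exact: near_eq_differentiable (nearbyT oU Ux fg) (df _ Ux).
apply: (IH _ _ oU _ (Df v)) => x Ux.
exact: near_eq_derive (nearbyT oU Ux fg).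
Qed.

Lemma C_on_sub V W k (U U' : set V) (f : V -> W) :
  U' `<=` U -> C_on k U f -> C_on k U' f.
Proof.
move=> UU; elim: k f => [|k IH] f /=; first by move=> h x /UU; exact: h.
by move=> [h1 h2]; split=> [x /UU|v]; [exact: h1|exact: IH].
Qed.

Lemma C_on_pred V W k (U : set V) (f : V -> W) : C_on k.+1 U f -> C_on k U f.
Proof.
elim: k f => [|k IH] f; last by move=> [df Df]; split=> // v; exact: IH.
by move=> [df _] x Ux; exact/differentiable_continuous/df.
Qed.

Lemma C_on_cst V W k (U : set V) (c : W) : C_on k U (fun=> c).
Proof.
elim: k c => [|k IH] c /=; first by move=> x _; exact: cst_continuous.
split=> [x _|v]; first exact: differentiable_cst.
have -> : (fun x : V => 'D_v (fun=> c) x) = fun=> 0.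
  by rewrite funeqE => x; exact: derive_cst.
exact: IH.
Qed.

Lemma C_onD V W k (U : set V) (f g : V -> W) : open U ->
  C_on k U f -> C_on k U g -> C_on k U (fun x => f x + g x).
Proof.
move=> oU; elim: k f g => [|k IH] f g /=.
  by move=> cf cg x Ux; exact: cvgD (cf _ Ux) (cg _ Ux).
move=> [df Df] [dg Dg]; split=> [x Ux|v].
  exact: differentiableD (df _ Ux) (dg _ Ux).
apply: (C_on_ext oU) (IH _ _ (Df v) (Dg v)) => x Ux.
have [? ?] := (df _ Ux, dg _ Ux).
by rewrite -[fun y => f y + g y]/(f + g) deriveD//; exact: diff_derivable.
Qed.

Lemma C_onZ V W k (U : set V) (f : V -> R) (g : V -> W) : open U ->
  C_on k U f -> C_on k U g -> C_on k U (fun x => f x *: g x).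
Proof.
move=> oU; elim: k f g => [|k IH] f g.
  by move=> cf cg x Ux; exact: cvgZ (cf _ Ux) (cg _ Ux).
move=> Cf Cg; have [[df Df] [dg Dg]] := (Cf, Cg); split=> [x Ux|v].
  by have [] := is_diff_scale (df _ Ux) (dg _ Ux).
apply: (C_on_ext oU) (C_onD oU (IH _ _ (C_on_pred Cf) (Dg v))
                                (IH _ _ (Df v) (C_on_pred Cg))) => x Ux.
by rewrite derive_scale//; [exact: df|exact: dg].
Qed.

Lemma C_on_sum V W k (U : set V) (I : finType) (f : I -> V -> W) : open U ->
  (forall i, C_on k U (f i)) -> C_on k U (fun x => \sum_i f i x).
Proof.
move=> oU cf.
suff: C_on k U (\sum_i f i) by rewrite (_ : (fun x => _) = \sum_i f i)// fct_sumE.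
by elim/big_ind : _ => [|g h|i _]; [exact: C_on_cst|exact: C_onD|exact: cf].
Qed.

Lemma derive_coord V m (g : V -> 'rV[R]_m) (x v : V) a :
  differentiable g x -> 'D_v (fun y => g y 0 a) x = ('D_v g x) 0 a.
Proof.
by move=> dg; rewrite derive_mx ?mxE//; exact: diff_derivable.
Qed.

Lemma C_on_coord V m k (U : set V) (g : V -> 'rV[R]_m) a : open U ->
  C_on k U g -> C_on k U (fun x => g x 0 a).
Proof.
move=> oU; elim: k g => [|k IH] g /=.
  move=> cg x Ux; apply: (@continuous_comp _ _ _ g (fun z : 'rV_m => z 0 a)).
    exact: cg.
  exact: coord_continuous.
move=> [dg Dg]; split=> [x Ux|v].
  apply: (@differentiable_comp _ _ _ _ g (fun z : 'rV_m => z 0 a)).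
    exact: dg.
  exact: differentiable_coord.
by apply: (C_on_ext oU) (IH _ (Dg v)) => x /dg; move/derive_coord ->.
Qed.

(** [C_on] iterates derivatives along constant vectors only. The moving direction ['D_v g x] is
    therefore expanded in the standard basis: its coordinates become smooth coefficients, and the
    partial derivatives of [f] fall under the induction hypothesis. *)
Lemma C_on_comp V W m k (U : set V) (U' : set 'rV[R]_m) (f : 'rV[R]_m -> W)
    (g : V -> 'rV[R]_m) : open U -> open U' -> (forall x, U x -> U' (g x)) ->
  C_on k U g -> C_on k U' f -> C_on k U (f \o g).
Proof.
move=> oU oU' UU'; elim: k f => [|k IH] f.
  move=> cg cf x Ux; apply: (@continuous_comp _ _ _ g f); first exact: cg.
  exact: cf (UU' _ Ux).
move=> Cg Cf; have [[dg Dg] [df Df]] := (Cg, Cf); split=> [x Ux|v].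
  exact: differentiable_comp (dg _ Ux) (df _ (UU' _ Ux)).
have C a : C_on k U (fun x => ('D_v g x) 0 a *: ('D_(delta_mx 0 a) f \o g) x).
  apply: C_onZ => //; first exact: C_on_coord oU (Dg v).
  exact: IH (C_on_pred Cg) (Df _).
apply: (C_on_ext oU) (C_on_sum oU C) => x Ux /=.
have [dgx dfx] := (dg _ Ux, df _ (UU' _ Ux)).
by rewrite derive_comp_rV// derive_rV.
Qed.

End ContinuouslyDifferentiable.

(** * Germs of smooth maps *)

Section SmoothNear.
Context {R : realType}.
Implicit Types V W : normedModType R.

(** [smooth_at p f] unfolds to this property of [f \o psi p] at [phi p p], so the lemmas below
    transfer to manifolds by conversion. *)
Definition smooth_near V W (x : V) (f : V -> W) : Prop :=
  exists U : set V, [/\ open U, U x & smooth_on U f].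

Lemma smooth_on_near V W (U : set V) (x : V) (f : V -> W) :
  nbhs x U -> smooth_on U f -> smooth_near x f.
Proof.
move=> /nbhs_interior/nbhs_singleton Ux sf; exists U°.
split=> // [|k]; first exact: open_interior.
exact: C_on_sub (@interior_subset _ U) (sf k).
Qed.

Lemma smooth_near_near V W (x : V) (f : V -> W) :
  smooth_near x f -> \near x, smooth_near x f.
Proof.
by move=> [U [oU Ux sf]]; apply: (nearbyT oU Ux) => y Uy; exists U.
Qed.

Lemma smooth_near_ext V W (x : V) (f g : V -> W) :
  (\near x, f x = g x) -> smooth_near x f -> smooth_near x g.
Proof.
move=> /nbhs_interior fg [U [oU Ux sf]].
exists (U `&` [set x | f x = g x]°); split.
- exact: openI (open_interior _).
- by split => //; exact: nbhs_singleton fg.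
move=> k; apply: (@C_on_ext _ _ _ _ _ f).
- exact: openI (open_interior _).
- by move=> y [_ /interior_subset].
- by apply: C_on_sub (sf k) => y [].
Qed.

Lemma smooth_near_diff V W (x : V) (f : V -> W) :
  smooth_near x f -> differentiable f x.
Proof. by move=> [U [_ Ux /(_ 1%N)[df _]]]; exact: df. Qed.

Lemma smooth_near_derive V W (x v : V) (f : V -> W) :
  smooth_near x f -> smooth_near x ('D_v f).
Proof. move=> [U [oU Ux sf]]; exists U; split=> // k.
by have [_] := sf k.+1; exact. Qed.

Lemma smooth_near_cst V W (x : V) (c : W) : smooth_near x (fun=> c).
Proof. exists setT; split=> [||k]; [exact: openT|by []|exact: C_on_cst]. Qed.

Lemma smooth_nearD V W (x : V) (f g : V -> W) :
  smooth_near x f -> smooth_near x g -> smooth_near x (fun y => f y + g y).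
Proof.
move=> [U [oU Ux sf]] [U' [oU' Ux' sg]]; exists (U `&` U').
have oI := openI oU oU'; split=> // k.
by apply: C_onD => //; [apply: C_on_sub (sf k)|apply: C_on_sub (sg k)] => y [].
Qed.

Lemma smooth_nearZ V W (x : V) (f : V -> R) (g : V -> W) :
  smooth_near x f -> smooth_near x g -> smooth_near x (fun y => f y *: g y).
Proof.
move=> [U [oU Ux sf]] [U' [oU' Ux' sg]]; exists (U `&` U').
have oI := openI oU oU'; split=> // k.
by apply: C_onZ => //; [apply: C_on_sub (sf k)|apply: C_on_sub (sg k)] => y [].
Qed.

Lemma smooth_near_sum V W (I : finType) (x : V) (f : I -> V -> W) :
  (forall i, smooth_near x (f i)) -> smooth_near x (fun y => \sum_i f i y).
Proof.
move=> sf; suff: smooth_near x (\sum_i f i).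
  by rewrite (_ : (fun x => _) = \sum_i f i)// fct_sumE.
elim/big_ind : _ => [|g h|i _] => //; [exact: smooth_near_cst|].
exact: smooth_nearD.
Qed.

Lemma smooth_near_coord V m (x : V) (g : V -> 'rV[R]_m) a :
  smooth_near x g -> smooth_near x (fun y => g y 0 a).
Proof.
by move=> [U [oU Ux sg]]; exists U; split=> // k; exact: C_on_coord.
Qed.

Lemma smooth_near_comp V W m (x : V) (f : 'rV[R]_m -> W) (g : V -> 'rV[R]_m) :
  smooth_near x g -> smooth_near (g x) f -> smooth_near x (f \o g).
Proof.
move=> sg [U' [oU' Ux' sf]]; have [U [oU Ux sgU]] := sg.
have : nbhs x (g @^-1` U').
  apply: (differentiable_continuous (smooth_near_diff sg)).
  exact: open_nbhs_nbhs.
move=> /nbhs_interior/nbhs_singleton Ig.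
have oI := openI oU (open_interior (g @^-1` U')).
exists (U `&` (g @^-1` U')°); split=> // k; apply: C_on_comp (sf k) => //.
  by move=> y [_ /interior_subset].
by apply: C_on_sub (sgU k) => y [].
Qed.

End SmoothNear.

(** * Charts and vector fields *)

Section Charts.
Context {R : realType} {n : nat} {M : manifold R n}.
Implicit Types (p q r : M) (W : normedModType R) (v w : 'rV[R]_n).

Lemma dom_near p q : dom p q -> \near q, dom p q.
Proof. by move=> pq; apply: open_nbhs_nbhs; split=> //; exact: open_dom. Qed.

Lemma psi_near p q (P : set M) : dom p q -> (\near q, P q) ->
  \forall x \near phi p q, P (psi p x).
Proof.
move=> pq; have : psi p @ phi p q --> psi p (phi p q) by exact: psi_continuous.
by rewrite phiK//; exact.
Qed.

Lemma phi_near p q (P : set 'rV[R]_n) : dom p q -> (\forall x \near phi p q, P x) ->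
  \near q, P (phi p q).
Proof. by move=> pq; exact: (phi_continuous pq). Qed.

(** [phiK] gives one composite of [phi p] and [psi p]; the other is the identity near [phi p q]
    because the image of the chart is open. *)
Lemma psiK_near p q : dom p q ->
  \forall x \near phi p q, dom p (psi p x) /\ phi p (psi p x) = x.
Proof.
move=> pq; have : nbhs (phi p q) (phi p @` dom p).
  by apply: open_nbhs_nbhs; split; [exact: open_codom|exists q].
by apply: filterS => _ [r pr <-]; rewrite phiK.
Qed.

Lemma transition_near p p' q : dom p q -> dom p' q ->
  smooth_near (phi p q) (phi p' \o psi p).
Proof.
move=> pq p'q; apply: smooth_on_near (transition_smooth p p').
apply: filterS2 (psiK_near pq) (psi_near pq (dom_near p'q)) => x [px xE] p'x.
by exists (psi p x).
Qed.

Lemma smooth_chart p p' q W (f : M -> W) : dom p q -> dom p' q ->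
  smooth_near (phi p q) (f \o psi p) -> smooth_near (phi p' q) (f \o psi p').
Proof.
move=> pq p'q sf.
apply: (@smooth_near_ext _ _ _ _ ((f \o psi p) \o (phi p \o psi p'))).
  by apply: filterS (psi_near p'q (dom_near pq)) => x px /=; rewrite phiK.
apply: smooth_near_comp; first exact: transition_near.
by rewrite /= phiK.
Qed.

(** [smooth_at q] refers to the chart at [q]; this allows one fixed chart [p] while [q] varies. *)
Lemma smooth_atP p q W (f : M -> W) : dom p q ->
  smooth_at q f <-> smooth_near (phi p q) (f \o psi p).
Proof. by move=> pq; split; apply: smooth_chart => //; exact: mem_dom. Qed.

Lemma smooth_at_near p W (f : M -> W) : smooth_at p f -> \near p, smooth_at p f.
Proof.
move=> /smooth_near_near /(phi_near (mem_dom p)) sf.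
by apply: filterS2 (dom_near (mem_dom p)) sf => q pq; exact: (smooth_atP _ pq).2.
Qed.

Lemma smooth_at_diff p W (f : M -> W) :
  smooth_at p f -> differentiable (f \o psi p) (phi p p).
Proof. exact: smooth_near_diff. Qed.

Lemma smooth_at_ext p W (f g : M -> W) :
  (\near p, f p = g p) -> smooth_at p f -> smooth_at p g.
Proof. by move=> /(psi_near (mem_dom p)); exact: smooth_near_ext. Qed.

Lemma smooth_at_cst p W (c : W) : smooth_at p (fun=> c).
Proof. exact: smooth_near_cst. Qed.

Lemma smooth_atD p W (f g : M -> W) :
  smooth_at p f -> smooth_at p g -> smooth_at p (fun q => f q + g q).
Proof. exact: smooth_nearD. Qed.

Lemma smooth_atZ p W (f : M -> R) (g : M -> W) :
  smooth_at p f -> smooth_at p g -> smooth_at p (fun q => f q *: g q).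
Proof. exact: smooth_nearZ. Qed.

Lemma smooth_at_sum p W (I : finType) (f : I -> M -> W) :
  (forall i, smooth_at p (f i)) -> smooth_at p (fun q => \sum_i f i q).
Proof. exact: smooth_near_sum. Qed.

Lemma smooth_at_coord p m (f : M -> 'rV[R]_m) a :
  smooth_at p f -> smooth_at p (fun q => f q 0 a).
Proof. exact: smooth_near_coord. Qed.

Lemma deriv_ext p v W (f g : M -> W) :
  (\near p, f p = g p) -> deriv p v f = deriv p v g.
Proof. by move=> /(psi_near (mem_dom p)) fg; exact: near_eq_derive. Qed.

Lemma deriv_linear p W (f : M -> W) a v w : smooth_at p f ->
  deriv p (a *: v + w) f = a *: deriv p v f + deriv p w f.
Proof. by move=> /smooth_at_diff df; rewrite /deriv !deriveE// linearP. Qed.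

Lemma deriv_atD p W (f g : M -> W) v : smooth_at p f -> smooth_at p g ->
  deriv p v (fun q => f q + g q) = deriv p v f + deriv p v g.
Proof.
move=> /smooth_at_diff df /smooth_at_diff dg; rewrite /deriv -deriveD//;
  exact: diff_derivable.
Qed.

Lemma deriv_atZ p W (f : M -> R) (g : M -> W) v : smooth_at p f -> smooth_at p g ->
  deriv p v (fun q => f q *: g q) = f p *: deriv p v g + deriv p v f *: g p.
Proof.
move=> /smooth_at_diff df /smooth_at_diff dg.
have := derive_scale v df dg; rewrite /= phiK//; exact: mem_dom.
Qed.

Lemma deriv_at_cst p W (c : W) v : deriv p v (fun=> c) = 0.
Proof. exact: derive_cst. Qed.

Lemma deriv_at_sum p W (I : finType) (f : I -> M -> W) v :
  (forall i, smooth_at p (f i)) ->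
  deriv p v (fun q => \sum_i f i q) = \sum_i deriv p v (f i).
Proof.
move=> sf; pose K (g : M -> W) u := smooth_at p g /\ deriv p v g = u.
suff [] : K (\sum_i f i) (\sum_i deriv p v (f i)) by rewrite fct_sumE.
elim/big_rec2 : _ => [|i u g _ [sg <-]].
  by split; [exact: smooth_at_cst|exact: deriv_at_cst].
by split; [exact: smooth_atD|exact: deriv_atD].
Qed.

Lemma chart_changeE p p' q v : dom p q -> dom p' q ->
  chart_change p p' q v = 'D_v (phi p' \o psi p) (phi p q).
Proof.
by move=> pq p'q; rewrite deriveE//; exact/smooth_near_diff/transition_near.
Qed.

Lemma chart_change_id p q v : dom p q -> chart_change p p q v = v.
Proof.
move=> pq; rewrite chart_changeE// -[RHS](derive_id (phi p q)).
by apply: near_eq_derive; apply: filterS (psiK_near pq) => x [].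
Qed.

Lemma chart_change_comp p p' p'' q v : dom p q -> dom p' q -> dom p'' q ->
  chart_change p' p'' q (chart_change p p' q v) = chart_change p p'' q v.
Proof.
move=> pq p'q p''q; rewrite (chart_changeE v pq p'q) (chart_changeE v pq p''q).
rewrite (chart_changeE _ p'q p''q).
have -> : phi p' q = (phi p' \o psi p) (phi p q) by rewrite /= phiK.
have d1 := smooth_near_diff (transition_near pq p'q).
have d2 : differentiable (phi p'' \o psi p') ((phi p' \o psi p) (phi p q)).
  by rewrite /= (phiK pq); exact/smooth_near_diff/transition_near.
rewrite -(derive_comp_rV v d1 d2); apply: near_eq_derive.
by apply: filterS (psi_near pq (dom_near p'q)) => x p'x /=; rewrite phiK.
Qed.

(** Here [Z] lists components in the chart [p]. They multiply the partial derivatives of the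
    transition map, which are smooth. *)
Lemma chart_change_smooth p p' q (Z : M -> 'rV[R]_n) : dom p q -> dom p' q ->
  smooth_at q Z -> smooth_at q (fun r => chart_change p p' r (Z r)).
Proof.
move=> pq p'q sZ.
have sa a : smooth_at q (fun r => Z r 0 a *: chart_change p p' r (delta_mx 0 a)).
  apply: smooth_atZ; first exact: smooth_at_coord.
  apply/(smooth_atP _ pq).
  apply: smooth_near_ext (smooth_near_derive (delta_mx 0 a) (transition_near pq p'q)).
  apply: filterS2 (psiK_near pq) (psi_near pq (dom_near p'q)) => x [px xE] p'x /=.
  by rewrite (chart_changeE _ px p'x) xE.
apply: smooth_at_ext (smooth_at_sum sa); apply: filterE => r.
rewrite /chart_change [in RHS](row_sum_delta (Z r)) linear_sum.
by apply: eq_bigr => a _; rewrite linearZ.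
Qed.

Lemma deriv_chart p q W (f : M -> W) v : dom p q -> smooth_at q f ->
  deriv q v f = 'D_(chart_change q p q v) (f \o psi p) (phi p q).
Proof.
move=> pq sf; have qq := mem_dom q; rewrite chart_changeE//.
rewrite -[in phi p q](phiK qq) -derive_comp_rV /= ?phiK//.
- apply: near_eq_derive.
  by apply: filterS (psi_near qq (dom_near pq)) => x px /=; rewrite phiK.
- exact/smooth_near_diff/transition_near.
- exact/smooth_near_diff/smooth_atP.
Qed.

End Charts.

Section VectorFields.
Context {R : realType} {n : nat} {M : manifold R n}.
Implicit Types (p q r : M) (v w : 'rV[R]_n) (V : set M) (X Y : M -> 'rV[R]_n).

(** The field with constant components [v] in the chart at [p]. It extends a single tangent vector
    to a field around [p], as required by hypotheses quantified over fields; for a basis vector it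
    is [coord_field]. *)
Definition const_field p v q : 'rV[R]_n := chart_change p q q v.

Lemma const_field_id p v : const_field p v p = v.
Proof. exact/chart_change_id/mem_dom. Qed.

Lemma const_field_smooth p v : vector_field (dom p) (const_field p v).
Proof.
move=> q pq; have qq := mem_dom q.
apply: smooth_at_ext (chart_change_smooth pq qq (smooth_at_cst q v)).
apply: filterS2 (dom_near pq) (dom_near qq) => r pr qr.
by rewrite chart_change_comp//; exact: mem_dom.
Qed.

Lemma vector_field_sub V V' X : V' `<=` V -> vector_field V X -> vector_field V' X.
Proof. by move=> VV sX p /VV; exact: sX. Qed.

Lemma vector_fieldD V X Y : vector_field V X -> vector_field V Y ->
  vector_field V (fun q => X q + Y q).
Proof.
move=> sX sY p Vp; apply: smooth_at_ext (smooth_atD (sX _ Vp) (sY _ Vp)).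
by apply: filterE => q; rewrite /chart_change linearD.
Qed.

Lemma vector_fieldZ V (f : M -> R) X : smooth_fun V f -> vector_field V X ->
  vector_field V (fun q => f q *: X q).
Proof.
move=> sf sX p Vp; apply: smooth_at_ext (smooth_atZ (sf _ Vp) (sX _ Vp)).
by apply: filterE => q; rewrite /chart_change linearZ.
Qed.

Lemma vector_field0 V : vector_field V (fun=> 0).
Proof.
move=> p Vp; apply: smooth_at_ext (smooth_at_cst p 0).
by apply: filterE => q; rewrite /chart_change linear0.
Qed.

Lemma coord_field_sum p q v : dom p q ->
  v = \sum_a (chart_change q p q v) 0 a *: coord_field p a q.
Proof.
move=> pq; have qq := mem_dom q.
transitivity (chart_change p q q (chart_change q p q v)).
  by rewrite chart_change_comp// chart_change_id.
move: (chart_change q p q _) => w.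
rewrite /coord_field /chart_change [in LHS](row_sum_delta w) linear_sum.
by apply: eq_bigr => a _; rewrite linearZ.
Qed.

(** In the chart at [p], the moving direction [X q] becomes smooth coefficients in front of partial
    derivatives along fixed vectors. *)
Lemma deriv_smooth V (f : M -> R) X : smooth_fun V f -> vector_field V X ->
  smooth_fun V (fun q => deriv q (X q) f).
Proof.
move=> sf sX p Vp; have pp := mem_dom p.
have sa a : smooth_at p (fun q => (chart_change q p q (X q)) 0 a *:
    'D_(delta_mx 0 a) (f \o psi p) (phi p q)).
  apply: smooth_atZ; first by apply: smooth_at_coord; exact: sX.
  apply: smooth_near_ext (smooth_near_derive (delta_mx 0 a) (sf _ Vp)).
  by apply: filterS (psiK_near pp) => x [_ /= ->].
apply: smooth_at_ext (smooth_at_sum sa).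
apply: filterS2 (dom_near pp) (smooth_at_near (sf _ Vp)) => q pq sq.
by rewrite (deriv_chart _ pq)// derive_rV//; exact/smooth_near_diff/smooth_atP.
Qed.

End VectorFields.

(** * Smooth maps between manifolds *)

Section SmoothMaps.
Context {R : realType} {m n : nat} {M : manifold R m} {N : manifold R n}.
Variables (F : M -> N) (sF : smooth_map F).
Implicit Types (p q : M) (W : normedModType R) (v : 'rV[R]_m).

Lemma smooth_map_near p (P : set N) : (\forall r \near F p, P r) -> \near p, P (F p).
Proof. by have [cF _] := sF p; exact: cF. Qed.

Lemma smooth_map_at p : smooth_at p (phi (F p) \o F).
Proof. exact: (sF p).2. Qed.

Lemma smooth_at_comp p W (h : N -> W) : smooth_at (F p) h -> smooth_at p (h \o F).
Proof.
move=> sh; have fp := mem_dom (F p).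
apply: smooth_at_ext (_ : smooth_at p ((h \o psi (F p)) \o (phi (F p) \o F))).
  by apply: filterS (smooth_map_near (dom_near fp)) => q fq /=; rewrite (phiK fq).
apply: (smooth_near_comp (smooth_map_at p)).
by rewrite /= (phiK (mem_dom p)).
Qed.

Lemma deriv_comp p v W (h : N -> W) : smooth_at (F p) h ->
  deriv p v (h \o F) = deriv (F p) (tangent_map F p v) h.
Proof.
move=> sh; have [pp fp] := (mem_dom p, mem_dom (F p)).
have dF := smooth_at_diff (smooth_map_at p).
have dh := smooth_at_diff sh.
have -> : tangent_map F p v = 'D_v (phi (F p) \o F \o psi p) (phi p p).
  by rewrite deriveE.
rewrite /deriv; have -> : phi (F p) (F p) = (phi (F p) \o F \o psi p) (phi p p).
  by rewrite /= (phiK pp).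
have dh' : differentiable (h \o psi (F p)) ((phi (F p) \o F \o psi p) (phi p p)).
  by rewrite /= (phiK pp).
rewrite -(derive_comp_rV v dF dh').
apply: near_eq_derive.
apply: filterS (psi_near pp (smooth_map_near (dom_near fp))) => x fx /=.
by rewrite (phiK fx).
Qed.

(** [tangent_map F q] is read in charts that change with [q]. Read in the charts at [p] and [F p],
    it is the differential of a single coordinate expression of [F], whose smoothness can then be
    used. *)
Lemma tangent_map_chart p : \forall q \near p, forall v,
  chart_change (F q) (F p) (F q) (tangent_map F q v) =
  'D_(chart_change q p q v) (phi (F p) \o F \o psi p) (phi p q).
Proof.
have fp := mem_dom (F p).
near=> q => v.
have pq : dom p q by near: q; exact/dom_near/mem_dom.
have fq : dom (F p) (F q) by near: q; exact: smooth_map_near (dom_near fp).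
have sq : smooth_at q (phi (F p) \o F).
  by near: q; exact/smooth_at_near/smooth_map_at.
rewrite -(deriv_chart v pq sq).
have sphi : smooth_at (F q) (phi (F p)).
  exact: (transition_near (mem_dom (F q)) fq).
rewrite (deriv_comp v sphi) (chart_changeE _ (mem_dom (F q)) fq).
by [].
Unshelve. all: by end_near. Qed.

Lemma pushforward_smooth (V : set M) (Y : M -> 'rV[R]_m) : vector_field V Y ->
  section_along F V (fun q => tangent_map F q (Y q)).
Proof.
move=> sY p Vp; have pp := mem_dom p.
pose Fh := phi (F p) \o F \o psi p.
have sa a : smooth_at p (fun q =>
    (chart_change q p q (Y q)) 0 a *: 'D_(delta_mx 0 a) Fh (phi p q)).
  apply: smooth_atZ; first by apply: smooth_at_coord; exact: sY.
  apply: smooth_near_ext (smooth_near_derive (delta_mx 0 a) (smooth_map_at p)).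
  by apply: filterS (psiK_near pp) => x [_ /= ->].
apply: smooth_at_ext (smooth_at_sum sa).
near=> q.
have pq : dom p q by near: q; exact/dom_near.
have sq : smooth_at q (phi (F p) \o F).
  by near: q; exact/smooth_at_near/smooth_map_at.
rewrite (near (tangent_map_chart p) q)// [RHS]derive_rV//.
exact/smooth_near_diff/(smooth_atP _ pq).
Unshelve. all: by end_near. Qed.

End SmoothMaps.

(** * Duality along a map *)

Section MetricBilinear.
Context {R : realType} {n : nat} {M : manifold R n}.
Variables (g : M -> 'rV[R]_n -> 'rV[R]_n -> R) (sg : semi_riemannian g).
Implicit Types (p : M) (u v w : 'rV[R]_n).

Lemma metricP p (a : R) u v w : g p (a *: u + v) w = a * g p u w + g p v w.
Proof. exact: (metric_linear sg). Qed.

Lemma metricC p u v : g p u v = g p v u.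
Proof. exact: (metric_sym sg). Qed.

Lemma metric0l p v : g p 0 v = 0.
Proof. by have := metricP p (-1) 0 0 v; rewrite scaler0 addr0 mulN1r addNr. Qed.

Lemma metricDl p u v w : g p (u + v) w = g p u w + g p v w.
Proof. by rewrite -[u]scale1r metricP mul1r scale1r. Qed.

Lemma metricZl p (a : R) u w : g p (a *: u) w = a * g p u w.
Proof. by rewrite -[a *: u]addr0 metricP metric0l addr0. Qed.

Lemma metric_suml p (I : finType) (u : I -> 'rV[R]_n) w :
  g p (\sum_i u i) w = \sum_i g p (u i) w.
Proof.
by elim/big_rec2 : _ => [|i x y _ <-]; [exact: metric0l|exact: metricDl].
Qed.

Lemma metric_sumr p (I : finType) (u : I -> 'rV[R]_n) w :
  g p w (\sum_i u i) = \sum_i g p w (u i).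
Proof. by rewrite metricC metric_suml; apply: eq_bigr => i _; rewrite metricC. Qed.

Lemma metricZr p (a : R) u w : g p w (a *: u) = a * g p w u.
Proof. by rewrite metricC metricZl metricC. Qed.

End MetricBilinear.

Section CovariantDerivativeAlong.
Context {R : realType} {n : nat} {Mb : manifold R n.+1} {M : manifold R n}.
Variables (F : M -> Mb) (sF : smooth_map F).
Implicit Types (p q : M) (v : 'rV[R]_n) (Z : M -> 'rV[R]_n.+1).
Implicit Types D : Mb -> 'rV[R]_n.+1 -> (Mb -> 'rV[R]_n.+1) -> 'rV[R]_n.+1.

(** The components of [Z] in the fixed chart at [F p]; [section_along] asks precisely that this map
    be smooth at [p]. *)
Definition local_rep p Z q : 'rV[R]_n.+1 := chart_change (F q) (F p) (F q) (Z q).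

Lemma local_rep_id p Z : local_rep p Z p = Z p.
Proof. exact/chart_change_id/mem_dom. Qed.

Lemma cov_along_ext D p v Z Z' : (\near p, Z p = Z' p) ->
  cov_along F D p v Z = cov_along F D p v Z'.
Proof.
move=> ZZ; have ZZp : Z p = Z' p := nbhs_singleton ZZ.
rewrite /cov_along ZZp; apply/(congr1 (+%R^~ _))/deriv_ext.
by apply: filterS ZZ => q ->.
Qed.

Lemma cov_alongD D p v Z Z' :
  smooth_at p (local_rep p Z) -> smooth_at p (local_rep p Z') ->
  cov_along F D p v (fun q => Z q + Z' q) =
  cov_along F D p v Z + cov_along F D p v Z'.
Proof.
move=> sZ sZ'; have E : deriv p v (local_rep p (fun q => Z q + Z' q)) =
    deriv p v (fun q => local_rep p Z q + local_rep p Z' q).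
  by apply: deriv_ext; apply: filterE => q; rewrite /local_rep /chart_change linearD.
rewrite /cov_along E (deriv_atD v sZ sZ') addrACA; apply: congr1.
by rewrite -big_split; apply: eq_bigr => a _; rewrite mxE scalerDl.
Qed.

Lemma cov_alongZ D p v (f : M -> R) Z :
  smooth_at p f -> smooth_at p (local_rep p Z) ->
  cov_along F D p v (fun q => f q *: Z q) =
  deriv p v f *: Z p + f p *: cov_along F D p v Z.
Proof.
move=> sf sZ; rewrite /cov_along scalerDr addrA.
have -> : deriv p v (fun q => chart_change (F q) (F p) (F q) (f q *: Z q)) =
    deriv p v (fun q => f q *: local_rep p Z q).
  by apply: deriv_ext; apply: filterE => q; rewrite /chart_change linearZ.
rewrite deriv_atZ// local_rep_id [_ *: Z p + _]addrC; congr (_ + _ + _).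
by rewrite scaler_sumr; apply: eq_bigr => a _; rewrite mxE scalerA.
Qed.

Lemma cov_along_linear D p (a : R) v w Z : affine_connection D ->
  smooth_at p (local_rep p Z) ->
  cov_along F D p (a *: v + w) Z = a *: cov_along F D p v Z + cov_along F D p w Z.
Proof.
move=> cD sZ; rewrite /cov_along deriv_linear// scalerDr addrACA; congr (_ + _).
rewrite scaler_sumr -big_split; apply: eq_bigr => b _ /=.
rewrite /tangent_map linearP.
rewrite (conn_linear cD (open_dom (F p)) (const_field_smooth _)); last exact: mem_dom.
by rewrite scalerDr !scalerA mulrC.
Qed.

Lemma cov_alongE D p v Z : cov_along F D p v Z = \sum_a
  ((deriv p v (local_rep p Z)) 0 a *: coord_field (F p) a (F p) +
   Z p 0 a *: D (F p) (tangent_map F p v) (coord_field (F p) a)).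
Proof.
rewrite big_split; congr (_ + _).
rewrite [LHS]row_sum_delta; apply: eq_bigr => a _; congr (_ *: _).
exact/esym/const_field_id.
Qed.

Section Duality.
Variables (g : Mb -> 'rV[R]_n.+1 -> 'rV[R]_n.+1 -> R).
Variables (D Ds : Mb -> 'rV[R]_n.+1 -> (Mb -> 'rV[R]_n.+1) -> 'rV[R]_n.+1).
Hypothesis stat : statistical_manifold g D Ds.
Let sg := stat_metric stat.

(** [Z] and [Z'] are expanded in the coordinate fields [E a] at [F p]. The metric coefficients
    [G a b] are functions on [Mb], where the ambient duality applies, and the Leibniz rule handles
    the components. *)
Lemma duality_along p v Z Z' :
  smooth_at p (local_rep p Z) -> smooth_at p (local_rep p Z') ->
  deriv p v (fun q => g (F q) (Z q) (Z' q)) =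
  g (F p) (cov_along F D p v Z) (Z' p) + g (F p) (Z p) (cov_along F Ds p v Z').
Proof.
move=> sZ sZ'; have fp := mem_dom (F p).
pose E a := coord_field (F p) a.
pose G a b r := g r (E a r) (E b r).
pose w := tangent_map F p v.
have sE a : vector_field (dom (F p)) (E a) by exact: const_field_smooth.
have sGN a b : smooth_at (F p) (G a b).
  have := metric_smooth sg (open_dom (F p)) (sE a) (sE b); exact.
have sG a b : smooth_at p (G a b \o F) by exact: smooth_at_comp.
have dG a b : deriv p v (G a b \o F) =
    g (F p) (D (F p) w (E a)) (E b (F p)) + g (F p) (E a (F p)) (Ds (F p) w (E b)).
  rewrite (deriv_comp sF v (sGN a b)).
  (* The direction [w], given only at [F p], is extended by [const_field]. *)
  have := stat_duality stat (open_dom (F p)) (const_field_smooth w) (sE a) (sE b) fp.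
  by rewrite /cov const_field_id.
have sz := fun a => smooth_at_coord a sZ.
have sz' := fun a => smooth_at_coord a sZ'.
have sz'G a b : smooth_at p (fun q => local_rep p Z' q 0 b *: G a b (F q)).
  exact: smooth_atZ (sz' b) (sG a b).
have szz'G a b : smooth_at p (fun q => local_rep p Z q 0 a *:
    (local_rep p Z' q 0 b *: G a b (F q))).
  exact: smooth_atZ (sz a) (sz'G a b).
have -> : deriv p v (fun q => g (F q) (Z q) (Z' q)) = deriv p v (fun q =>
    \sum_a \sum_b local_rep p Z q 0 a *: (local_rep p Z' q 0 b *: G a b (F q))).
  apply: deriv_ext; apply: filterS (smooth_map_near sF (dom_near fp)) => q fq.
  rewrite {1}(coord_field_sum (Z q) fq) (metric_suml sg); apply: eq_bigr => a _.
  rewrite (metricZl sg) {1}(coord_field_sum (Z' q) fq) (metric_sumr sg) mulr_sumr.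
  by apply: eq_bigr => b _; rewrite (metricZr sg).
have Zp : Z p = \sum_a Z p 0 a *: E a (F p).
  by rewrite [LHS](coord_field_sum (Z p) fp) -/(local_rep p Z p) local_rep_id.
have Z'p : Z' p = \sum_b Z' p 0 b *: E b (F p).
  by rewrite [LHS](coord_field_sum (Z' p) fp) -/(local_rep p Z' p) local_rep_id.
have dz a : deriv p v (fun q => local_rep p Z q 0 a) = deriv p v (local_rep p Z) 0 a.
  exact: derive_coord (smooth_at_diff sZ).
have dz' b : deriv p v (fun q => local_rep p Z' q 0 b) = deriv p v (local_rep p Z') 0 b.
  exact: derive_coord (smooth_at_diff sZ').
rewrite !cov_alongE (metric_suml sg) (metric_sumr sg).
rewrite (deriv_at_sum _ (fun a => smooth_at_sum (szz'G a))).
under eq_bigr => a _.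
  rewrite (deriv_at_sum _ (szz'G a)).
  under eq_bigr => b _.
    rewrite (deriv_atZ _ (sz a) (sz'G a b)) (deriv_atZ _ (sz' b) (sG a b)).
    rewrite dz dz' !local_rep_id dG.
    over.
  over.
under [X in _ = X + _]eq_bigr => a _.
  rewrite (metricDl sg) !(metricZl sg) Z'p !(metric_sumr sg).
  under [X in _ * X + _]eq_bigr => b _ do rewrite (metricZr sg).
  under [X in _ + _ * X]eq_bigr => b _ do rewrite (metricZr sg).
  rewrite !mulr_sumr -big_split/=.
  over.
under [X in _ = _ + X]eq_bigr => b _.
  rewrite (metricC sg) (metricDl sg) !(metricZl sg) Zp !(metric_sumr sg).
  under [X in _ * X + _]eq_bigr => a _ do rewrite (metricZr sg) (metricC sg).
  under [X in _ + _ * X]eq_bigr => a _ do rewrite (metricZr sg) (metricC sg).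
  rewrite !mulr_sumr -big_split/=.
  over.
(* Both sides are now double sums over [a] and [b], and they match term by term. *)
rewrite [X in _ = _ + X]exchange_big -big_split; apply: eq_bigr => a _ /=.
rewrite -big_split; apply: eq_bigr => b _ /=.
rewrite -![_ *: _]/(_ * _) -/(E a) -/(E b) -/(G a b (F p)) -/w.
ring.
Qed.

End Duality.
End CovariantDerivativeAlong.

(** * Curvature *)

Section LocalConnections.
Context {R : realType} {n : nat} {M : manifold R n}.
Local Notation connection := (M -> 'rV[R]_n -> (M -> 'rV[R]_n) -> 'rV[R]_n).
Implicit Types (U V : set M) (D : connection) (X Y Z : M -> 'rV[R]_n).

(* The induced connections are only known over [U], through the Gauss formulas. *)
Record affine_on U D : Prop := {
  aff_smooth : forall V, open V -> V `<=` U -> forall X Y,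
    vector_field V X -> vector_field V Y -> vector_field V (cov D X Y) ;
  aff_local : forall V, open V -> V `<=` U -> forall Y Y',
    vector_field V Y -> vector_field V Y' ->
    (forall q, V q -> Y q = Y' q) ->
    forall p v, V p -> D p v Y = D p v Y' ;
  aff_linear : forall V, open V -> V `<=` U -> forall Y, vector_field V Y ->
    forall p (a : R) u v, V p -> D p (a *: u + v) Y = a *: D p u Y + D p v Y ;
  aff_add : forall V, open V -> V `<=` U -> forall Y Z,
    vector_field V Y -> vector_field V Z -> forall p v, V p ->
    D p v (fun q => Y q + Z q) = D p v Y + D p v Z ;
  aff_leibniz : forall V, open V -> V `<=` U -> forall f Y,
    smooth_fun V f -> vector_field V Y -> forall p v, V p ->
    D p v (fun q => f q *: Y q) = deriv p v f *: Y p + f p *: D p v Y }.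

(** The Leibniz rule survives because the weights add up to 1, so the derivative of [f] keeps its
    coefficient. *)
Lemma mean_affine U D D' : affine_on U D -> affine_on U D' ->
  affine_on U (mean_connection D D').
Proof.
move=> aD aD'; rewrite /mean_connection; split=> V oV VU.
- move=> X Y sX sY.
  have s1 := vector_fieldD (aff_smooth aD oV VU sX sY) (aff_smooth aD' oV VU sX sY).
  have s2 : smooth_fun V (fun=> 2^-1) by move=> p _; exact: smooth_at_cst.
  exact: vector_fieldZ s2 s1.
- move=> Y Y' sY sY' YY p v Vp.
  by rewrite (aff_local aD oV VU sY sY' YY _ Vp) (aff_local aD' oV VU sY sY' YY _ Vp).
- move=> Y sY p a u v Vp.
  rewrite (aff_linear aD oV VU sY _ _ _ Vp) (aff_linear aD' oV VU sY _ _ _ Vp).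
  by rewrite !scalerDr !scalerA ![2^-1 * a]mulrC addrACA.
- move=> Y Z sY sZ p v Vp.
  rewrite (aff_add aD oV VU sY sZ _ Vp) (aff_add aD' oV VU sY sZ _ Vp).
  by rewrite !scalerDr addrACA.
- move=> f Y sf sY p v Vp.
  rewrite (aff_leibniz aD oV VU sf sY _ Vp) (aff_leibniz aD' oV VU sf sY _ Vp).
  rewrite addrACA -scalerDl -(scalerDr (f p)) (scalerDr 2^-1) !scalerA.
  by rewrite [2^-1 * f p]mulrC -mulr2n -(mulr_natl (deriv p v f)) mulKf ?pnatr_eq0.
Qed.

Let add_rearrange (a a' b b' c c' : 'rV[R]_n) :
  a + a' - (b + b') - (c + c') = a - b - c + (a' - b' - c').
Proof. by apply/rowP => i; rewrite !mxE; ring. Qed.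

(** In [curvatureZ], [x] and [y] are the derivatives of [f] along [X] and [Y], and [dx], [dy] those
    of [Z]. The mixed products are symmetric in [X] and [Y] and cancel. *)
Let leibniz_rearrange (k l m x y c : R) (z dx dy d1 d2 d3 : 'rV[R]_n) :
  k *: z + y *: dx + (x *: dy + c *: d1) - (l *: z + x *: dy + (y *: dx + c *: d2))
  - (m *: z + c *: d3) = (k - l - m) *: z + c *: (d1 - d2 - d3).
Proof. by apply/rowP => i; rewrite !mxE; ring. Qed.

Section Curvature.
Variables (U V : set M) (VU : V `<=` U) (X Y : M -> 'rV[R]_n).
Hypotheses (sX : vector_field V X) (sY : vector_field V Y).

(** Serves to replace [Z] by an expansion that is valid only on a smaller open set [W] around
    [p]. *)
Lemma curvature_local D W Z Z' p : affine_on U D -> open W -> W `<=` V ->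
  vector_field W Z -> vector_field W Z' -> (forall q, W q -> Z q = Z' q) -> W p ->
  curvature D X Y Z p = curvature D X Y Z' p.
Proof.
move=> aD oW WV sZ sZ' ZZ Wp.
have WU := subset_trans WV VU.
have [sX' sY'] := (vector_field_sub WV sX, vector_field_sub WV sY).
have E T v : vector_field W T ->
    D p v (cov D T Z) = D p v (cov D T Z').
  move=> sT; apply: (aff_local aD oW WU) => //; try exact: (aff_smooth aD).
  by move=> q Wq; exact: (aff_local aD oW WU).
by rewrite /curvature {1 3}/cov !E// /cov (aff_local aD oW WU sZ sZ' ZZ).
Qed.

Lemma curvatureD D W Z Z' p : affine_on U D -> open W -> W `<=` V ->
  vector_field W Z -> vector_field W Z' -> W p ->
  curvature D X Y (fun q => Z q + Z' q) p =
  curvature D X Y Z p + curvature D X Y Z' p.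
Proof.
move=> aD oW WV sZ sZ' Wp.
have WU := subset_trans WV VU.
have [sX' sY'] := (vector_field_sub WV sX, vector_field_sub WV sY).
have sZZ := vector_fieldD sZ sZ'.
have aff T T' := @aff_smooth _ _ aD W oW WU T T'.
have E T v : vector_field W T ->
    D p v (cov D T (fun q => Z q + Z' q)) = D p v (cov D T Z) + D p v (cov D T Z').
  move=> sT; have [sTZ sTZ'] := (aff _ _ sT sZ, aff _ _ sT sZ').
  rewrite -(aff_add aD oW WU sTZ sTZ')//; apply: (aff_local aD oW WU) => //.
  - exact: aff.
  - exact: vector_fieldD.
  - by move=> q Wq; rewrite /cov (aff_add aD oW WU sZ sZ').
rewrite /curvature {1 3}/cov !E//.
rewrite [cov D (bracket X Y) _ p](aff_add aD oW WU sZ sZ' _ Wp).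
exact: add_rearrange.
Qed.

Lemma curvatureZ D W (f : M -> R) Z p : affine_on U D -> open W -> W `<=` V ->
  smooth_fun W f -> vector_field W Z -> W p ->
  curvature D X Y (fun q => f q *: Z q) p =
  (deriv p (X p) (fun q => deriv q (Y q) f) - deriv p (Y p) (fun q => deriv q (X q) f)
   - deriv p (bracket X Y p) f) *: Z p + f p *: curvature D X Y Z p.
Proof.
move=> aD oW WV sf sZ Wp.
have WU := subset_trans WV VU.
have [sX' sY'] := (vector_field_sub WV sX, vector_field_sub WV sY).
have sfZ := vector_fieldZ sf sZ.
have aff T T' := @aff_smooth _ _ aD W oW WU T T'.
have E T v : vector_field W T ->
    D p v (cov D T (fun q => f q *: Z q)) =
    deriv p v (fun q => deriv q (T q) f) *: Z p + deriv p (T p) f *: D p v Z +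
    (deriv p v f *: D p (T p) Z + f p *: D p v (cov D T Z)).
  move=> sT; have sTZ := aff _ _ sT sZ; have sTf := deriv_smooth sf sT.
  have [s1 s2] := (vector_fieldZ sTf sZ, vector_fieldZ sf sTZ).
  rewrite -(aff_leibniz aD oW WU sTf sZ)// -(aff_leibniz aD oW WU sf sTZ)//.
  rewrite -(aff_add aD oW WU s1 s2)//; apply: (aff_local aD oW WU) => //.
  - exact: aff.
  - exact: vector_fieldD.
  - by move=> q Wq; rewrite /cov (aff_leibniz aD oW WU sf sZ).
rewrite /curvature {1 3}/cov !E//.
rewrite [cov D (bracket X Y) _ p](aff_leibniz aD oW WU sf sZ _ Wp).
exact: leibniz_rearrange.
Qed.

End Curvature.
End LocalConnections.

(** * Recurrent fields and sections of distributions *)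

Section RecurrentFields.
Context {R : realType} {n : nat} {M : manifold R n}.
Local Notation connection := (M -> 'rV[R]_n -> (M -> 'rV[R]_n) -> 'rV[R]_n).
Implicit Types (U V : set M) (D : connection) (X Y xi : M -> 'rV[R]_n).

Lemma smooth_at_opp p (f : M -> R) : smooth_at p f -> smooth_at p (fun q => - f q).
Proof.
move=> sf; have := smooth_atZ (smooth_at_cst p (-1 : R)) sf.
by apply: smooth_at_ext; apply: filterE => q; exact: mulN1r.
Qed.

Lemma deriv_at_opp p v (f : M -> R) : smooth_at p f ->
  deriv p v (fun q => - f q) = - deriv p v f.
Proof.
by move=> /smooth_at_diff df; rewrite /deriv -deriveN//; exact: diff_derivable.
Qed.

(** Differentiating twice produces the product of the values of [t] on [X] and [Y], which is
    symmetric and cancels. The derivatives of [t] remain; the factor 2 undoes the normalization in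
    [ext_deriv]. *)
Lemma curvature_recurrent D U V X Y xi (t : M -> 'rV[R]_n -> R) p :
  affine_on U D ->
  open V -> V `<=` U -> one_form U t -> vector_field V xi ->
  (forall q v, V q -> D q v xi = - t q v *: xi q) ->
  vector_field V X -> vector_field V Y -> V p ->
  curvature D X Y xi p = - (2 * ext_deriv t X Y p) *: xi p.
Proof.
move=> aD oV VU [_ ts] sxi Dxi sX sY Vp.
have st T : vector_field V T -> smooth_fun V (fun q => t q (T q)) by exact: ts.
have E T S : vector_field V T -> vector_field V S -> cov D S (cov D T xi) p =
    (t p (T p) * t p (S p) - deriv p (S p) (fun q => t q (T q))) *: xi p.
  move=> sT sS; have stT := st _ sT.
  have sN : smooth_fun V (fun q => - t q (T q)).
    by move=> q Vq; exact/smooth_at_opp/stT.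
  have -> : cov D S (cov D T xi) p = D p (S p) (fun q => - t q (T q) *: xi q).
    apply: (aff_local aD oV VU) => //; first exact: (aff_smooth aD).
      exact: vector_fieldZ.
    by move=> q Vq; exact: Dxi.
  rewrite (aff_leibniz aD oV VU sN sxi)// (deriv_at_opp _ (stT _ Vp)) Dxi//.
  by rewrite scalerA mulrNN -scalerDl addrC.
rewrite /curvature !E// /cov Dxi// -!scalerBl; congr (_ *: _).
rewrite /ext_deriv mulVKf ?pnatr_eq0//.
ring.
Qed.

(** Take the coordinates of [w] in a local frame at [p] and keep them constant. *)
Lemma distribution_extend (S : M -> {vspace 'rV[R]_n}) p w :
  smooth_distribution S -> w \in S p ->
  exists V W, [/\ open V, V p, section_of (fun q => [set` S q]) V W & W p = w].
Proof.
move=> /(_ p)[V [s [oV Vp ss sb]]] wS.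
pose X := in_tuple [seq E p | E : M -> 'rV[R]_n <- s].
have wX : w \in <<X>>%VS by rewrite (span_basis (sb p Vp)).
pose f i q : 'rV[R]_n := coord X i w *: nth 0 s i q.
have lts (i : 'I_(size [seq E p | E : M -> 'rV[R]_n <- s])) : (i < size s)%N.
  by rewrite -(size_map (fun E : M -> 'rV[R]_n => E p)).
have sf i : section_of (fun q => [set` S q]) V (f i).
  split; first by apply: vector_fieldZ; [move=> q _; exact: smooth_at_cst|exact: ss].
  move=> q Vq; apply: memvZ; apply: (basis_mem (sb q Vq)).
  by apply: map_f; exact: mem_nth.
exists V, (\sum_i f i); split=> //; last first.
  rewrite fct_sumE [RHS](coord_span wX); apply: eq_bigr => i _; congr (_ *: _).
  by rewrite /= (nth_map 0).
elim/big_ind : _ => [|Y Z [sY SY] [sZ SZ]|i _]; last exact: sf.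
  by split; [exact: vector_field0|move=> q _; exact: mem0v].
split; first exact: vector_fieldD.
by move=> q Vq; apply: memvD; [exact: SY|exact: SZ].
Qed.

End RecurrentFields.

(** * Comparison of the curvatures of two connections *)

Section CurvatureComparison.
Context {R : realType} {n : nat} {M : manifold R n}.
Local Notation connection := (M -> 'rV[R]_n -> (M -> 'rV[R]_n) -> 'rV[R]_n).
Variables (U : set M) (D D' : connection).
Hypotheses (aD : affine_on U D) (aD' : affine_on U D').
Implicit Types (V : set M) (X Y Z : M -> 'rV[R]_n).

(* The second order terms of [curvatureZ] do not depend on the connection, so  *)
(* the difference of two curvatures is tensorial.                              *)
Lemma curvature_diff_tensor V X Y p :
  open V -> V `<=` U -> vector_field V X -> vector_field V Y -> V p ->
  exists A : 'M[R]_n, forall W Z, open W -> W `<=` V -> vector_field W Z -> W p ->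
    curvature D X Y Z p - curvature D' X Y Z p = Z p *m A.
Proof.
move=> oV VU sX sY Vp.
pose K Z := curvature D X Y Z p - curvature D' X Y Z p.
pose E a := coord_field p a : M -> 'rV[R]_n.
(* The rows are the values of the difference on the coordinate fields at [p], so the matrix is
   chosen before [W] and [Z]. *)
exists (\matrix_a K (E a)) => W Z oW WV sZ Wp; rewrite -/(K Z).
have pp := mem_dom p; pose z a q := (chart_change q p q (Z q)) 0 a.
(* The components of [Z] in the chart at [p] are known to be smooth only near [p]; the interior of
   [good] is the open set on which the expansion is valid. *)
pose good q := W q /\ dom p q /\ forall a, smooth_at q (z a).
have nz a : \forall q \near p, smooth_at q (z a).
  by apply: smooth_at_near; apply: smooth_at_coord; exact: sZ.
have ngood : \forall q \near p, good q.
  near=> q; split; first by near: q; exact: open_nbhs_nbhs.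
  split; first by near: q; exact: dom_near.
  by near: q; exact: filter_forall.
pose W' := good°.
have oW' : open W' by exact: open_interior.
have W'p : W' p by have /nbhs_interior/nbhs_singleton := ngood.
have gW' q : W' q -> good q by exact: interior_subset.
have W'W : W' `<=` W by move=> q /gW'[].
have W'V := subset_trans W'W WV.
have sE a : vector_field W' (E a).
  by apply: vector_field_sub (const_field_smooth _) => q /gW'[_ []].
have sz a : smooth_fun W' (z a) by move=> q /gW'[_ [_]].
have szE a := vector_fieldZ (sz a) (sE a).
have KD Z1 Z2 : vector_field W' Z1 -> vector_field W' Z2 ->
    K (fun q => Z1 q + Z2 q) = K Z1 + K Z2.
  move=> s1 s2; rewrite /K (curvatureD VU sX sY aD oW' W'V s1 s2 W'p).
  by rewrite (curvatureD VU sX sY aD' oW' W'V s1 s2 W'p) opprD addrACA.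
have KZ a : K (fun q => z a q *: E a q) = z a p *: K (E a).
  rewrite /K (curvatureZ VU sX sY aD oW' W'V (sz a) (sE a) W'p).
  rewrite (curvatureZ VU sX sY aD' oW' W'V (sz a) (sE a) W'p).
  by rewrite opprD addrACA subrr add0r -scalerBr.
have K0 : K (fun=> 0) = 0.
  have s0 : vector_field W' (fun=> 0) by exact: vector_field0.
  have := KD _ _ s0 s0.
  have -> : (fun q : M => 0 + 0 : 'rV[R]_n) = fun=> 0.
    by rewrite funeqE => q; rewrite addr0.
  by move/eqP; rewrite eq_sym -subr_eq0 addrK => /eqP.
have [sS KS] : vector_field W' (\sum_a (fun q => z a q *: E a q)) /\
    K (\sum_a (fun q => z a q *: E a q)) = \sum_a z a p *: K (E a).
  elim/big_rec2 : _ => [|a u Z1 _ [s1 <-]]; first by split=> //; exact: vector_field0.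
  by split; [exact: vector_fieldD|rewrite -KZ -KD].
have ZS q : W' q -> Z q = (\sum_a (fun q => z a q *: E a q)) q.
  by move=> /gW'[_ [pq _]]; rewrite fct_sumE [LHS](coord_field_sum (Z q) pq).
have sZ' := vector_field_sub W'W sZ.
rewrite {1}/K (curvature_local VU sX sY aD oW' W'V sZ' sS ZS W'p).
rewrite (curvature_local VU sX sY aD' oW' W'V sZ' sS ZS W'p) -/(K _) KS.
rewrite [Z p]row_sum_delta mulmx_suml; apply: eq_bigr => a _.
by rewrite -scalemxAl -rowE rowK /z chart_change_id.
Unshelve. all: by end_near. Qed.

Variable S : M -> {vspace 'rV[R]_n}.
Local Notation screen := (fun p => [set` S p]).

(** Since [D'] preserves the screen, the derivative of [W] is again a screen section, and the
    agreement of [D] and [D'] can be used a second time. *)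
Lemma curvature_agree V X Y W p :
  parallel U screen D' ->
  (forall V, open V -> V `<=` U -> forall W, section_of screen V W ->
    forall q v, V q -> D q v W = D' q v W) ->
  open V -> V `<=` U -> vector_field V X -> vector_field V Y ->
  section_of screen V W -> V p -> curvature D X Y W p = curvature D' X Y W p.
Proof.
move=> pD' DD oV VU sX sY SW Vp.
have E T v : vector_field V T -> D p v (cov D T W) = D' p v (cov D' T W).
  move=> sT; have SDW := pD' V oV VU T W sT SW; have [sW _] := SW.
  rewrite -(DD V oV VU _ SDW)//; apply: (aff_local aD oV VU) => //.
  - exact: (aff_smooth aD).
  - by have [] := SDW.
  - by move=> q Vq; exact: DD SW _ _ Vq.
by rewrite /curvature {1 3}/cov !E// /cov (DD V oV VU W SW).
Qed.

Variables (xi : M -> 'rV[R]_n) (t t' : M -> 'rV[R]_n -> R).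

(** Evaluating on [xi], which vanishes nowhere, recovers the exterior derivatives from the
    curvatures. Conversely, by tensoriality it suffices to compare on a screen section through the
    screen part of [Z p] and on [xi]. *)
Lemma same_curvatureP :
  smooth_distribution S -> vector_field U xi -> (forall p, U p -> xi p != 0) ->
  (forall p v, U p -> exists w c, w \in S p /\ v = w + c *: xi p) ->
  one_form U t -> one_form U t' ->
  (forall p v, U p -> D p v xi = - t p v *: xi p) ->
  (forall p v, U p -> D' p v xi = - t' p v *: xi p) ->
  parallel U screen D' ->
  (forall V, open V -> V `<=` U -> forall W, section_of screen V W ->
    forall q v, V q -> D q v W = D' q v W) ->
  same_curvature U D D' <-> same_ext_deriv U t t'.
Proof.
move=> sS sxi xi0 Sxi ft ft' Dxi Dxi' pD' DD.
have Kxi (V : set M) X Y p : open V -> V `<=` U ->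
    vector_field V X -> vector_field V Y -> V p -> curvature D X Y xi p = - (2 * ext_deriv t X Y p) *: xi p /\
           curvature D' X Y xi p = - (2 * ext_deriv t' X Y p) *: xi p.
  move=> oV VU sX sY Vp; have sxiV := vector_field_sub VU sxi.
  split.
    by apply: (curvature_recurrent aD oV VU ft sxiV) => // q v /VU; exact: Dxi.
  by apply: (curvature_recurrent aD' oV VU ft' sxiV) => // q v /VU; exact: Dxi'.
split=> [KK V oV VU X Y sX sY p Vp|tt V oV VU X Y Z sX sY sZ p Vp].
  have [E E'] := Kxi V X Y p oV VU sX sY Vp.
  have /eqP := KK V oV VU X Y xi sX sY (vector_field_sub VU sxi) p Vp.
  rewrite E E' -subr_eq0 -scalerBl scaler_eq0 (negbTE (xi0 _ (VU _ Vp))) orbF.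
  rewrite opprK addrC subr_eq0 => /eqP.
  have two0 : (2 : R) != 0 by rewrite pnatr_eq0.
  by move/(mulfI two0).
have [A KA] := curvature_diff_tensor oV VU sX sY Vp.
apply/subr0_eq; rewrite (KA V Z)//.
have [w [c [wS ->]]] := Sxi p (Z p) (VU _ Vp).
have [V' [W [oV' V'p SW Wp]]] := distribution_extend sS wS.
have oI := openI oV oV'; have IV : V `&` V' `<=` V by move=> q [].
have IU := subset_trans IV VU.
have SWI : section_of screen (V `&` V') W.
  have [sW WS] := SW; split; first by apply: vector_field_sub sW => q [].
  by move=> q [_ V'q]; exact: WS.
have [sWI _] := SWI.
rewrite mulmxDl -Wp -(KA _ _ oI IV sWI (conj Vp V'p)).
rewrite (@curvature_agree (V `&` V') X Y W p)//; last first.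
- exact: vector_field_sub sY.
- exact: vector_field_sub sX.
have [E E'] := Kxi V X Y p oV VU sX sY Vp.
rewrite -scalemxAl -(KA V xi)//; last exact: vector_field_sub sxi.
by rewrite E E' (tt V oV VU X Y sX sY p Vp) !subrr scaler0 addr0.
Qed.

End CurvatureComparison.

(** * Lightlike hypersurfaces *)

Section LightlikeHypersurface.
Context {R : realType} {n : nat} {Mb : manifold R n.+1} {M : manifold R n}.
Variables (F : M -> Mb) (gb : Mb -> 'rV[R]_n.+1 -> 'rV[R]_n.+1 -> R).
Variables (S : M -> {vspace 'rV[R]_n}) (U : set M).
Variables (xi : M -> 'rV[R]_n) (N : M -> 'rV[R]_n.+1).
Hypotheses (iF : immersion F) (sg : semi_riemannian gb).
Hypotheses (sS : screen_distribution F gb S) (oU : open U).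
Hypotheses (rxi : radical_section F gb U xi).
Hypotheses (tN : transversal_section F gb S U xi N).
Local Notation dF := (tangent_map F).
Local Notation screen := (fun p => [set` S p]).
Implicit Types (p q : M) (v w : 'rV[R]_n) (V : set M) (X Y Z : M -> 'rV[R]_n).

Let sF : smooth_map F := iF.1.

Lemma tangent_mapP p (a : R) v w : dF p (a *: v + w) = a *: dF p v + dF p w.
Proof. exact: linearP. Qed.

Lemma tangent_mapD p v w : dF p (v + w) = dF p v + dF p w.
Proof. exact: linearD. Qed.

Lemma tangent_mapZ p (a : R) v : dF p (a *: v) = a *: dF p v.
Proof. exact: linearZ. Qed.

Lemma radical_linear p (a : R) v w : radical F gb p v -> radical F gb p w ->
  radical F gb p (a *: v + w).
Proof.
move=> rv rw u; rewrite tangent_mapP (metric_linear sg).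
by rewrite rv rw mulr0 addr0.
Qed.

(** Pairing with [xi] kills the tangent parts and, as [N] pairs to 1 with [xi], isolates [b] and
    [c]; injectivity of the differential does the rest. *)
Lemma transversal_inj p v w (b c : R) : U p ->
  dF p v + b *: N p = dF p w + c *: N p -> v = w /\ b = c.
Proof.
move=> Up E; have [_ N1 _] := tN.2 p Up; have rad := rxi.1.2 p Up.
have : gb (F p) (dF p v + b *: N p) (dF p (xi p)) =
       gb (F p) (dF p w + c *: N p) (dF p (xi p)) by rewrite E.
have rad0 u : gb (F p) (dF p u) (dF p (xi p)) = 0 by rewrite (metricC sg) rad.
rewrite !(metricDl sg) !(metricZl sg) N1 !mulr1 !rad0 !add0r => bc; split=> //.
by apply: (iF.2 p); move: E; rewrite bc => /addIr.
Qed.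

Lemma transversal_span p (y : 'rV[R]_n.+1) : U p ->
  exists v b, y = dF p v + b *: N p.
Proof.
(* The rows of [P] are the images of the basis vectors, then [N p]. It is square, so the
   independence from [transversal_inj] makes these rows span. *)
move=> Up; pose P := col_mx (lin1_mx (dF p)) (N p).
have PE (x : 'rV[R]_(n + 1)) : x *m P = dF p (lsubmx x) + rsubmx x 0 0 *: N p.
  rewrite -{1}[x]hsubmxK mul_row_col mul_rV_lin1.
  by rewrite {1}[rsubmx x]mx11_scalar mul_scalar_mx.
have /eqP rP : row_free P.
  apply: inj_row_free => x; rewrite PE => xP.
  have xP' : dF p (lsubmx x) + rsubmx x 0 0 *: N p = dF p 0 + 0 *: N p.
    by rewrite xP scale0r addr0 /tangent_map linear0.
  have [x1 x2] := transversal_inj Up xP'.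
  rewrite -[x]hsubmxK x1 [rsubmx x]mx11_scalar x2.
  by rewrite raddf0 row_mx0.
have : row_full P by rewrite /row_full rP addn1.
move=> /(submx_full y)/submxP[x ->]; rewrite PE.
by exists (lsubmx x), (rsubmx x 0 0).
Qed.

(** With this [c], the vector [v - c *: xi p] is radical and its image is orthogonal to [N] as well,
    hence to the whole ambient space; nondegeneracy of [gb] makes it zero. *)
Lemma radical_line p v : U p -> radical F gb p v -> exists c, v = c *: xi p.
Proof.
move=> Up rv; pose c := gb (F p) (N p) (dF p v); exists c.
have [_ N1 _] := tN.2 p Up; have rad := rxi.1.2 p Up.
apply/subr0_eq; apply: (iF.2 p); rewrite [RHS]/tangent_map linear0.
apply: (metric_nondegenerate sg (p := F p)) => y.
have [w [b ->]] := transversal_span y Up.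
have rvc : radical F gb p (v - c *: xi p).
  by rewrite addrC -scaleNr; exact: radical_linear.
rewrite (metricC sg) (metricDl sg) (metricZl sg) (metricC sg _ (dF p w)).
rewrite rvc add0r.
rewrite (metricC sg) addrC -scaleNr tangent_mapP (metric_linear sg).
by rewrite !(metricC sg _ _ (N p)) N1 mulr1 -/c addNr mulr0.
Qed.

Lemma screen_decomposition p v : U p ->
  exists w c, w \in S p /\ v = w + c *: xi p.
Proof.
move=> Up; have [w [r [wS rr ->]]] := screen_sum sS p v.
by have [c ->] := radical_line Up rr; exists w, c.
Qed.

Section Gauss.
Variables (Db : Mb -> 'rV[R]_n.+1 -> (Mb -> 'rV[R]_n.+1) -> 'rV[R]_n.+1).
Variables (D : M -> 'rV[R]_n -> (M -> 'rV[R]_n) -> 'rV[R]_n).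
Variables (B : M -> 'rV[R]_n -> 'rV[R]_n -> R).
Hypotheses (cDb : affine_connection Db) (gauss : gauss_formula F Db U N D B).

(** A pointwise Gauss formula: the vector [v] is extended to a field near [p]. *)
Lemma gauss_at V Y p v : open V -> V `<=` U -> vector_field V Y -> V p ->
  exists b, cov_along F Db p v (fun q => dF q (Y q)) = dF p (D p v Y) + b *: N p.
Proof.
move=> oV VU sY Vp; have pp := mem_dom p.
have oI := openI oV (open_dom p); have IV : V `&` dom p `<=` V by move=> q [].
have sv : vector_field (V `&` dom p) (const_field p v).
  by apply: vector_field_sub (const_field_smooth v) => q [].
have [_] := gauss oI (subset_trans IV VU) sv (vector_field_sub IV sY).
move=> /(_ p (conj Vp pp)); rewrite /cov const_field_id => ->.
by exists (B p v (Y p)).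
Qed.

Lemma gauss_eq V Y p v w (b : R) : open V -> V `<=` U -> vector_field V Y -> V p ->
  cov_along F Db p v (fun q => dF q (Y q)) = dF p w + b *: N p -> D p v Y = w.
Proof.
move=> oV VU sY Vp E; have [c] := gauss_at v oV VU sY Vp.
by rewrite E => /(transversal_inj (VU _ Vp))[].
Qed.

(** Each axiom holds for [cov_along]. Exhibiting some transversal coefficient for the combined
    expression suffices, because [gauss_eq] then reads off the tangent part. *)
Lemma gauss_affine : affine_on U D.
Proof.
have push V Y p : vector_field V Y -> V p ->
    smooth_at p (local_rep F p (fun q => dF q (Y q))).
  by move=> sY Vp; have := pushforward_smooth sF sY Vp.
split=> V oV VU.
- by move=> X Y sX sY; have [] := gauss oV VU sX sY.
- move=> Y Y' sY sY' YY p v Vp; have [b E] := gauss_at v oV VU sY' Vp.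
  apply: (gauss_eq (b := b) oV VU sY Vp); rewrite -E.
  apply: cov_along_ext; apply: filterS (open_nbhs_nbhs (conj oV Vp)) => q Vq.
  by rewrite YY.
- move=> Y sY p a u v Vp.
  have [b E] := gauss_at u oV VU sY Vp; have [b' E'] := gauss_at v oV VU sY Vp.
  apply: (gauss_eq (b := a * b + b') oV VU sY Vp).
  rewrite (cov_along_linear _ _ _ cDb (push _ _ _ sY Vp)) E E' tangent_mapP.
  by rewrite scalerDr scalerA scalerDl addrACA.
- move=> Y Z sY sZ p v Vp.
  have [b E] := gauss_at v oV VU sY Vp; have [b' E'] := gauss_at v oV VU sZ Vp.
  apply: (gauss_eq (b := b + b') oV VU (vector_fieldD sY sZ) Vp).
  rewrite tangent_mapD scalerDl addrACA -E -E'.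
  rewrite -(cov_alongD _ _ (push _ _ _ sY Vp) (push _ _ _ sZ Vp)).
  by apply: cov_along_ext; apply: filterE => q; exact: tangent_mapD.
- move=> f Y sf sY p v Vp; have [b E] := gauss_at v oV VU sY Vp.
  apply: (gauss_eq (b := f p * b) oV VU (vector_fieldZ sf sY) Vp).
  rewrite tangent_mapP tangent_mapZ -addrA -scalerA -scalerDr -E.
  rewrite -(cov_alongZ _ _ (sf p Vp) (push _ _ _ sY Vp)).
  by apply: cov_along_ext; apply: filterE => q; exact: tangent_mapZ.
Qed.

(** The derivative of [xi] is radical by parallelism, so [A p v] is both radical and in the screen,
    hence zero. *)
Lemma weingarten_recurrent A t : weingarten_xi S U xi D A t ->
  parallel U (radical F gb) D -> forall p v, U p -> D p v xi = - t p v *: xi p.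
Proof.
move=> [_ W] pR p v Up; have [AS E] := W p Up v.
have pp := mem_dom p; have oI := openI oU (open_dom p).
have IU : U `&` dom p `<=` U by move=> q [].
have sv : vector_field (U `&` dom p) (const_field p v).
  by apply: vector_field_sub (const_field_smooth v) => q [].
have rx : section_of (radical F gb) (U `&` dom p) xi.
  split; first exact: vector_field_sub IU rxi.1.1.
  by move=> q /IU; exact: rxi.1.2.
have [_ /(_ p (conj Up pp))] := pR _ oI IU _ _ sv rx.
rewrite /cov const_field_id => rD.
suff A0 : A p v = 0 by rewrite E A0 oppr0 add0r scaleNr.
apply: (screen_direct sS AS).
have rad0 : radical F gb p 0 by move=> u; rewrite /tangent_map linear0 (metric0l sg).
have -> : A p v = -1 *: (t p v *: xi p + D p v xi) + 0.
  by rewrite addr0 E [X in _ *: X]addrC subrK scaleN1r opprK.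
by apply: radical_linear => //; apply: radical_linear => //; exact: rxi.1.2.
Qed.

End Gauss.

Variables (nablab nablabs : Mb -> 'rV[R]_n.+1 -> (Mb -> 'rV[R]_n.+1) -> 'rV[R]_n.+1).
Variables (nabla nablas : M -> 'rV[R]_n -> (M -> 'rV[R]_n) -> 'rV[R]_n).
Variables (B Bs : M -> 'rV[R]_n -> 'rV[R]_n -> R).
Hypothesis stat : statistical_manifold gb nablab nablabs.
Hypotheses (gauss : gauss_formula F nablab U N nabla B).
Hypotheses (gausss : gauss_formula F nablabs U N nablas Bs).
Hypotheses (pS : parallel U screen nabla) (pSs : parallel U screen nablas).
Hypothesis metr : metric_connection U (induced_metric F gb) nabla.

(** [N] is orthogonal to the screen, so the transversal terms of both Gauss formulas drop out of the
    ambient duality. *)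
Lemma induced_metric_duality V Y Z q v : open V -> V `<=` U ->
  section_of screen V Y -> section_of screen V Z -> V q ->
  deriv q v (fun r => induced_metric F gb r (Y r) (Z r)) =
  induced_metric F gb q (nabla q v Y) (Z q) +
  induced_metric F gb q (Y q) (nablas q v Z).
Proof.
move=> oV VU [sY SY] [sZ SZ] Vq; have [_ _ NS] := tN.2 q (VU _ Vq).
have [b E] := gauss_at gauss v oV VU sY Vq.
have [c E'] := gauss_at gausss v oV VU sZ Vq.
have [sFY sFZ] := (pushforward_smooth sF sY Vq, pushforward_smooth sF sZ Vq).
rewrite (duality_along sF stat v sFY sFZ).
rewrite E E' (metricDl sg) (metricC sg (F q) _ (_ + _)) (metricDl sg) !(metricZl sg).
rewrite !NS; [|exact: SY|exact: SZ].
by rewrite !mulr0 !addr0 (metricC sg _ (dF q (nablas q v Z))).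
Qed.

(** Both derivatives lie in the nondegenerate screen, so it is enough to pair their difference with
    screen vectors [w']. Extending [w'] to a screen section, metricity and duality give two
    expressions for the same derivative, whose difference is this pairing. *)
Lemma screen_connections_agree V W q v : open V -> V `<=` U ->
  section_of screen V W -> V q -> nabla q v W = nablas q v W.
Proof.
move=> oV VU SW Vq; apply/subr0_eq.
have restrict V' : V' `<=` V -> section_of screen V' W.
  move=> VV; have [sW WS] := SW; split; first exact: vector_field_sub sW.
  by move=> r /VV; exact: WS.
have const_sub V' : V' `<=` dom q -> vector_field V' (const_field q v).
  by move=> Vd; exact: vector_field_sub (const_field_smooth v).
have inS D : parallel U screen D -> D q v W \in S q.
  move=> pD; have oI := openI oV (open_dom q).
  have IV : V `&` dom q `<=` V by move=> r [].
  have Id : V `&` dom q `<=` dom q by move=> r [].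
  have [_] := pD _ oI (subset_trans IV VU) _ _ (const_sub _ Id) (restrict _ IV).
  by move=> /(_ q (conj Vq (mem_dom q))); rewrite /cov const_field_id.
apply: (screen_nondegenerate sS); first exact: memvB (inS _ pS) (inS _ pSs).
move=> w' w'S.
have [V' [W' [oV' V'q SW' <-]]] := distribution_extend (screen_smooth sS) w'S.
pose I := V `&` V' `&` dom q.
have oI : open I by apply: openI (open_dom q); exact: openI.
have Iq : I q by do 2?split=> //; exact: mem_dom.
have IV : I `<=` V by move=> r [[]].
have IU := subset_trans IV VU.
have SWI := restrict _ IV.
have SWI' : section_of screen I W'.
  have [sW' WS'] := SW'; split; first by apply: vector_field_sub sW' => r [[]].
  by move=> r [[_ V'r] _]; exact: WS'.
have svI : vector_field I (const_field q v) by apply: const_sub => r [].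
have := metr oI IU svI SWI.1 SWI'.1 Iq.
rewrite /cov_form /cov const_field_id.
(* The arguments are exchanged so that the duality puts [nabla] on [W'] and [nablas] on [W]; the
   [nabla] terms on [W'] then cancel. *)
have -> : (fun r => induced_metric F gb r (W r) (W' r)) =
          (fun r => induced_metric F gb r (W' r) (W r)).
  by rewrite funeqE => r; rewrite /induced_metric (metricC sg).
rewrite (induced_metric_duality v oI IU SWI' SWI Iq).
rewrite /induced_metric tangent_mapD -(scaleN1r (nablas q v W)) tangent_mapZ.
rewrite (metricDl sg) (metricZl sg) mulN1r.
rewrite (metricC sg _ (dF q (W q))) (metricC sg _ (dF q (W' q))).
rewrite addrAC [X in X - _ - _ = _]addrC addrK => /eqP.
by rewrite subr_eq0 => /eqP ->; rewrite subrr.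
Qed.

End LightlikeHypersurface.

(** * The recurrence form of the mean connection *)

Section MeanForm.
Context {R : realType} {n : nat} {M : manifold R n}.
Implicit Types (U V : set M) (t : M -> 'rV[R]_n -> R) (X Y : M -> 'rV[R]_n).

Definition mean_form t t' p (v : 'rV[R]_n) : R := 2^-1 * (t p v + t' p v).

Lemma smooth_at_mean p (f g : M -> R) : smooth_at p f -> smooth_at p g ->
  smooth_at p (fun q => 2^-1 * (f q + g q)).
Proof.
by move=> sf sg; exact: smooth_atZ (smooth_at_cst p (2^-1 : R)) (smooth_atD sf sg).
Qed.

Lemma deriv_at_mean p v (f g : M -> R) : smooth_at p f -> smooth_at p g ->
  deriv p v (fun q => 2^-1 * (f q + g q)) = 2^-1 * (deriv p v f + deriv p v g).
Proof.
move=> sf sg; have := deriv_atZ v (smooth_at_cst p (2^-1 : R)) (smooth_atD sf sg).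
by rewrite deriv_at_cst deriv_atD// scale0r addr0.
Qed.

Lemma one_form_mean U t t' : one_form U t -> one_form U t' ->
  one_form U (mean_form t t').
Proof.
move=> [tl ts] [tl' ts']; split=> [p Up a u v|V oV VU X sX p Vp].
  by rewrite /mean_form tl// tl'//; ring.
by apply: smooth_at_mean; [exact: ts Vp|exact: ts' Vp].
Qed.

Lemma ext_deriv_mean U t t' V X Y p : one_form U t -> one_form U t' ->
  open V -> V `<=` U -> vector_field V X -> vector_field V Y -> V p ->
  ext_deriv (mean_form t t') X Y p =
  2^-1 * (ext_deriv t X Y p + ext_deriv t' X Y p).
Proof.
move=> [_ ts] [_ ts'] oV VU sX sY Vp.
rewrite /ext_deriv !deriv_at_mean; first by rewrite /mean_form; ring.
- exact: ts sX _ Vp.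
- exact: ts' sX _ Vp.
- exact: ts sY _ Vp.
- exact: ts' sY _ Vp.
Qed.

End MeanForm.

Theorem corollary3p12 (R : realType) (n : nat)
  (Mb : manifold R n.+1) (M : manifold R n) (F : M -> Mb)
  (gb : Mb -> 'rV[R]_n.+1 -> 'rV[R]_n.+1 -> R)
  (nablab nablabs :
     Mb -> 'rV[R]_n.+1 -> (Mb -> 'rV[R]_n.+1) -> 'rV[R]_n.+1)
  (Sc : M -> {vspace 'rV[R]_n})
  (U : set M) (xi : M -> 'rV[R]_n) (N : M -> 'rV[R]_n.+1)
  (nabla nablas : M -> 'rV[R]_n -> (M -> 'rV[R]_n) -> 'rV[R]_n)
  (B Bs : M -> 'rV[R]_n -> 'rV[R]_n -> R)
  (A As : M -> 'rV[R]_n -> 'rV[R]_n) (tau taus : M -> 'rV[R]_n -> R) :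
  statistical_manifold gb nablab nablabs ->
  lightlike_hypersurface F gb ->
  screen_distribution F gb Sc ->
  open U ->
  radical_section F gb U xi ->
  transversal_section F gb Sc U xi N ->
  gauss_formula F nablab U N nabla B ->
  gauss_formula F nablabs U N nablas Bs ->
  weingarten_xi Sc U xi nabla A tau ->
  weingarten_xi Sc U xi nablas As taus ->
  parallel U (radical F gb) nabla ->
  parallel U (radical F gb) nablas ->
  parallel U (fun p => [set` Sc p]) nabla ->
  parallel U (fun p => [set` Sc p]) nablas ->
  metric_connection U (induced_metric F gb) nabla ->
  let nabla0 := mean_connection nabla nablas in
  (forall V, open V -> V `<=` U -> forall X Y W,
     vector_field V X -> vector_field V Y ->
     section_of (fun p => [set` Sc p]) V W ->
     forall p, V p ->
     curvature nabla X Y W p = curvature nablas X Y W p /\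
     curvature nablas X Y W p = curvature nabla0 X Y W p) /\
  (same_curvature U nabla nablas <-> same_ext_deriv U tau taus) /\
  (same_curvature U nabla nablas ->
     same_curvature U nabla nablas /\ same_curvature U nablas nabla0).
Proof.
move=> stat lh sS oU rxi tN G Gs We Wes pR pRs pS pSs metr nabla0.
have [iF _] := lh.
have sg := stat_metric stat.
have aD := gauss_affine iF sg rxi tN (stat_connection stat) G.
have aDs := gauss_affine iF sg rxi tN (stat_dual_connection stat) Gs.
have aD0 : affine_on U nabla0 by exact: mean_affine.
have agree V (oV : open V) (VU : V `<=` U) W
    (SW : section_of (fun p => [set` Sc p]) V W) q v (Vq : V q) :
    nabla q v W = nablas q v W.
  exact: (screen_connections_agree iF sg sS tN stat G Gs pS pSs metr v oV VU SW Vq).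
have half (u : 'rV[R]_n) : 2^-1 *: (u + u) = u.
  by rewrite -mulr2n -(scaler_nat 2 u) scalerA mulVf ?pnatr_eq0// scale1r.
have agree0 V (oV : open V) (VU : V `<=` U) W
    (SW : section_of (fun p => [set` Sc p]) V W) q v (Vq : V q) :
    nabla0 q v W = nablas q v W.
  by rewrite /nabla0 /mean_connection (agree V oV VU W SW q v Vq) half.
have Dxi := weingarten_recurrent sg sS oU rxi We pR.
have Dsxi := weingarten_recurrent sg sS oU rxi Wes pRs.
have [ft fts] := (We.1, Wes.1).
have D0xi p v : U p -> nabla0 p v xi = - mean_form tau taus p v *: xi p.
  move=> Up; rewrite /nabla0 /mean_connection Dxi// Dsxi//.
  by rewrite -scalerDl scalerA -opprD mulrN.
have sd := screen_smooth sS.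
have iff1 : same_curvature U nabla nablas <-> same_ext_deriv U tau taus.
  apply: (same_curvatureP aD aDs sd rxi.1.1 rxi.2 _ ft fts Dxi Dsxi pSs agree).
  by move=> p v; exact: screen_decomposition iF sg sS rxi tN p v.
(* The same criterion, with [nabla0] and the mean form in place of [nabla] and [tau]. *)
have iff2 :
    same_curvature U nabla0 nablas <-> same_ext_deriv U (mean_form tau taus) taus.
  have ft0 := one_form_mean ft fts.
  apply: (same_curvatureP aD0 aDs sd rxi.1.1 rxi.2 _ ft0 fts D0xi Dsxi pSs agree0).
  by move=> p v; exact: screen_decomposition iF sg sS rxi tN p v.
split; [|split=> // KK].
  move=> V oV VU X Y W sX sY SW p Vp; split.
    exact: (curvature_agree aD pSs agree oV VU sX sY SW Vp).
  exact/esym/(curvature_agree aD0 pSs agree0 oV VU sX sY SW Vp).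
split=> // V oV VU X Y Z sX sY sZ p Vp; apply/esym.
(* When the two exterior derivatives coincide, their mean is that of [taus]. *)
apply: iff2.2 V oV VU X Y Z sX sY sZ p Vp => V oV VU X Y sX sY p Vp.
rewrite (ext_deriv_mean ft fts oV VU sX sY Vp) (iff1.1 KK V oV VU X Y sX sY p Vp).
by rewrite -mulr2n -(mulr_natl (ext_deriv taus X Y p)) mulKf ?pnatr_eq0.
Qed.
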